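(* Assume $\lim_{n\to\infty}X'X/n=Q$ exists and is positive definite, that $k_2=1$, and that $Q_{12}=0$. Then for every $\beta\in M_R$ and every $t\in\mathbb{R}^k$ there exist $\delta_0>0$ and $0<\rho_0<\infty$ (which may be chosen depending only on $t,Q,\sigma,\alpha$) such that: (i) every estimator $\hat F_n(t)$ satisfying $\mathbb{P}_{n,\beta,\sigma}(|\hat F_n(t)-F_{n,\beta,\sigma}(t)|>\delta)\to0$ for every $\delta>0$ also satisfies $$\sup_{\vartheta\in\mathbb{R}^k,\ \|\vartheta-\beta\|<\rho_0/\sqrt n}\mathbb{P}_{n,\vartheta,\sigma}\big(|\hat F_n(t)-F_{n,\vartheta,\sigma}(t)|>\delta_0\big)\to1\quad(n\to\infty);$$ (ii) $\liminf_{n\to\infty}\inf_{\hat F_n(t)}\sup_{\|\vartheta-\beta\|<\rho_0/\sqrt n}\mathbb{P}_{n,\vartheta,\sigma}(|\hat F_n(t)-F_{n,\vartheta,\sigma}(t)|>\delta_0)>0$; (iii) $\sup_{\delta>0}\liminf_{n\to\infty}\inf_{\hat F_n(t)}\sup_{\|\vartheta-\beta\|<\rho_0/\sqrt n}\mathbb{P}_{n,\vartheta,\sigma}(|\hat F_n(t)-F_{n,\vartheta,\sigma}(t)|>\delta)\ge\tfrac12$, where the infima range over all estimators $\hat F_n(t)$.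
   Context: Setup: for each sample size $n$, $Y=X\beta+u$, $X$ a non-stochastic $n\times k$ matrix of full column rank $k$ (so $n\ge k$), $k>1$, $u\sim N(0,\sigma^2I_n)$, $\sigma^2>0$ known; $\mathbb{P}_{n,\beta,\sigma}$ is the distribution of $Y$ on $\mathbb{R}^n$. Partition $X=[X_1:X_2]$, $\beta=(\beta_1',\beta_2')'$, $X_i$ having $k_i\ge1$ columns; $Q$ partitioned conformably into $Q_{11},Q_{12},Q_{21},Q_{22}$. $M_R=\{\beta\in\mathbb{R}^k:\beta_2=0\}$. $\hat\beta(R)=\big(((X_1'X_1)^{-1}X_1'Y)',0\big)'$, $\hat\beta(U)=(X'X)^{-1}X'Y$, $\tilde\beta=\hat\lambda\hat\beta(R)+(1-\hat\lambda)\hat\beta(U)$, $\hat\lambda=[1+\exp(-2\alpha k_2)\exp(\alpha\|X\hat\beta(R)-X\hat\beta(U)\|^2/\sigma^2)]^{-1}$, $\alpha>0$. $F_{n,\beta,\sigma}(t)=\mathbb{P}_{n,\beta,\sigma}(\sqrt n(\tilde\beta-\beta)\le t)$, componentwise inequality. An estimator $\hat F_n(t)$ of $F_{n,\beta,\sigma}(t)$ is any real-valued measurable function of $Y$ (and the known $X$), not necessarily taking values in $[0,1]$. *)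

(* Defs.v *)
From HB Require Import structures.
From mathcomp Require Import all_boot all_order all_algebra.
From mathcomp Require Import all_classical all_reals all_analysis.
Set Implicit Arguments. Unset Strict Implicit. Unset Printing Implicit Defensive.
Import Order.TTheory GRing.Theory Num.Theory.
Import numFieldNormedType.Exports.
Local Open Scope classical_set_scope.
Local Open Scope ring_scope.

Section Defs.
Context {R : realType}.

Definition posdef m (Q : 'M[R]_m) : Prop :=
  Q^T = Q /\ forall v : 'cV[R]_m, v != 0 -> 0 < (v^T *m Q *m v) 0 0.

Definition sqnorm m (v : 'cV[R]_m) : R := \sum_(i < m) (v i 0) ^+ 2.
Definition enorm m (v : 'cV[R]_m) : R := Num.sqrt (sqnorm v).

(* Integral of f against the n-fold product of N(0, s^2) on R^n
   (data vectors in R^n are n.-tuples), defined by iterated integration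
   against the normal density. *)
Fixpoint gauss_int (s : R) (n : nat) : (n.-tuple R -> \bar R) -> \bar R :=
  match n return (n.-tuple R -> \bar R) -> \bar R with
  | 0 => fun f => f [tuple]
  | m.+1 => fun f =>
      (\int[lebesgue_measure]_x
         ((normal_pdf 0 s x)%:E * gauss_int s (fun y => f (cons_tuple x y))))%E
  end.

Definition gauss_prob (s : R) (n : nat) (A : set (n.-tuple R)) : \bar R :=
  gauss_int s (fun u => (\1_A u)%:E).

Definition colv n (y : n.-tuple R) : 'cV[R]_n := \col_i tnth y i.

Definition Ydata k n (X : 'M[R]_(n, k)) (theta : 'cV[R]_k) (u : n.-tuple R)
  : n.-tuple R := [tuple (X *m theta) i 0 + tnth u i | i < n].

Definition PY k n (X : 'M[R]_(n, k)) (sigma : R) (theta : 'cV[R]_k)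
  (E : set (n.-tuple R)) : \bar R :=
  gauss_prob sigma [set u | E (Ydata X theta u)].

(* restricted / unrestricted least squares, k = k1 + k2 with k2 = 1 *)
Definition betaR k1 n (X : 'M[R]_(n, k1 + 1)) (Y : 'cV[R]_n) : 'cV[R]_(k1 + 1) :=
  let X1 := lsubmx X in col_mx (invmx (X1^T *m X1) *m X1^T *m Y) 0.
Definition betaU k n (X : 'M[R]_(n, k)) (Y : 'cV[R]_n) : 'cV[R]_k :=
  invmx (X^T *m X) *m X^T *m Y.

Definition k2 : nat := 1.

Definition lambda_hat k1 n (X : 'M[R]_(n, k1 + 1)) (sigma alpha : R)
  (Y : 'cV[R]_n) : R :=
  (1 + expR (- (2 * alpha * k2%:R)) *
       expR (alpha * sqnorm (X *m betaR X Y - X *m betaU X Y) / sigma ^+ 2))^-1.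

Definition beta_tilde k1 n (X : 'M[R]_(n, k1 + 1)) (sigma alpha : R)
  (Y : 'cV[R]_n) : 'cV[R]_(k1 + 1) :=
  let l := lambda_hat X sigma alpha Y in
  l *: betaR X Y + (1 - l) *: betaU X Y.

Definition Fdist k1 n (X : 'M[R]_(n, k1 + 1)) (sigma alpha : R)
  (theta t : 'cV[R]_(k1 + 1)) : \bar R :=
  PY X sigma theta [set Y | forall i,
     Num.sqrt (n%:R) * (beta_tilde X sigma alpha (colv Y) - theta) i 0 <= t i 0].

Definition err_prob k1 n (X : 'M[R]_(n, k1 + 1)) (sigma alpha : R)
  (t : 'cV[R]_(k1 + 1)) (Fhat : n.-tuple R -> R) (theta : 'cV[R]_(k1 + 1))
  (delta : R) : \bar R :=
  PY X sigma theta
    [set Y | delta < `| Fhat Y - fine (Fdist X sigma alpha theta t) |].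

Definition sup_err k1 n (X : 'M[R]_(n, k1 + 1)) (sigma alpha : R)
  (t : 'cV[R]_(k1 + 1)) (Fhat : n.-tuple R -> R) (beta : 'cV[R]_(k1 + 1))
  (rho delta : R) : \bar R :=
  ereal_sup [set err_prob X sigma alpha t Fhat theta delta |
             theta in [set theta | enorm (theta - beta) < rho / Num.sqrt (n%:R)]].

Definition estimators n : set (n.-tuple R -> R) :=
  [set f | measurable_fun [set: n.-tuple R] f].

Definition minimax_err k1 n (X : 'M[R]_(n, k1 + 1)) (sigma alpha : R)
  (t : 'cV[R]_(k1 + 1)) (beta : 'cV[R]_(k1 + 1)) (rho delta : R) : \bar R :=
  ereal_inf [set sup_err X sigma alpha t f beta rho delta | f in @estimators n].

End Defs.
Arguments estimators {R} n _.

(* Main.v *)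
(* Let S = X'X/n and Z = sqrt n (betaU - theta) = G u with G G' = S^-1.  The normal
   equations give betaR - betaU = (betaU)_l e, where l is the last coordinate and
   e = (D, -1) with D = (X1'X1)^-1 X1'X2, so that at theta = beta + (0, g / sqrt n),
   with z = Z_l + g,
     sqrt n (beta_tilde - theta)_i = Z_i + lambda(z) e_i z,
   and D -> 0 because Q12 = 0.  Its last coordinate is at most t_l iff
   (1 - lambda(z)) z <= t_l + g.  For g = - t_l this means Z_l <= t_l, whereas for
   g = eps - t_l it differs from Z_l <= t_l by at least an interval of values of Z_l,
   as 0 < lambda < 1.  Hence the cdfs at these two local parameters stay apart for
   every eps <> 0.  The joint law of Z is never needed: the probability that Z_l is
   in that interval while the other Z_i are small is bounded below by shifting the
   mean (Cameron-Martin) until the other constraints fail with small probability, and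
   the corrections lambda(z) D_i z are absorbed by the anti-concentration of the one
   dimensional normal laws of the Z_i.

   The likelihood ratio of two local parameters has second moment exp(r), with
   r = |mean shift|^2 / sigma^2 bounded in n, which gives contiguity, hence (i).  As
   eps -> 0 the total variation distance between the parameters eps - t_l and - t_l
   is O(eps), and Le Cam's two-point argument gives (ii) and (iii). *)

Require Import Defs.
From HB Require Import structures.
From mathcomp Require Import all_boot all_order all_algebra.
From mathcomp Require Import all_classical all_reals all_analysis.
From mathcomp Require Import measurable_realfun ring lra.
Set Implicit Arguments. Unset Strict Implicit.
Import Order.TTheory GRing.Theory Num.Theory.
Import numFieldNormedType.Exports.
Local Open Scope classical_set_scope.
Local Open Scope ring_scope.

(** * Lebesgue and Gaussian integrals *)

Section lebesgue_affine.
Context {R : realType}.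
Local Notation mu := (@lebesgue_measure R).

(** The pushforward of Lebesgue measure under a translation has the right value on half-open
    intervals, and this characterizes Lebesgue measure. The scaling lemma below applies the same
    argument to [a] times the pushforward. *)
Lemma integral_translation (b : R) (f : R -> \bar R) :
  measurable_fun [set: R] f -> (forall x, 0 <= f x)%E ->
  (\int[mu]_x f (x + b)%R = \int[mu]_x f x)%E.
Proof.
move=> mf f0.
pose phi := (fun x : measurableTypeR R => x + b : measurableTypeR R).
have mphi : measurable_fun [set: measurableTypeR R] phi.
  by apply: (@measurable_funD _ R R).
rewrite -[LHS](@ge0_integral_pushforward _ _ _ _ _ phi mphi mu setT f)//.
apply: eq_measure_integral => A mA _; apply/esym/lebesgue_measure_unique => //.
move=> _ [[x y]] _ <-; rewrite /pushforward.
rewrite [X in _ = mu X](_ : _ = [set` `]x - b, y - b]]); last first.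
  by apply/seteqP; split=> z /=; rewrite !in_itv/= ltrBlDr lerBrDr.
rewrite /= !lebesgue_measure_itv/= !lte_fin ltrD2r.
by case: ifP => // _; rewrite -!EFinB; congr (_%:E); lra.
Qed.

Lemma integral_scaling (a : R) (f : R -> \bar R) : 0 < a ->
  measurable_fun [set: R] f -> (forall x, 0 <= f x)%E ->
  (a%:E * \int[mu]_x f (a * x)%R = \int[mu]_x f x)%E.
Proof.
move=> a0 mf f0.
pose phi := (fun x : measurableTypeR R => a * x : measurableTypeR R).
have mphi : measurable_fun [set: measurableTypeR R] phi.
  by apply: (@measurable_funM _ R R).
rewrite -[X in (_ * X)%E](@ge0_integral_pushforward _ _ _ _ _ phi mphi mu setT f)//.
have a0' : (0 <= a)%R by exact: ltW.
rewrite -(@ge0_integral_mscale _ _ _ (pushforward mu phi) _ measurableT (NngNum a0'))//.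
apply: eq_measure_integral => A mA _; apply/esym/lebesgue_measure_unique => //.
move=> _ [[x y]] _ <-; rewrite /mscale/= /pushforward/=.
rewrite [X in _ = (_ * mu X)%E](_ : _ = [set` `]a^-1 * x, a^-1 * y]]); last first.
  by apply/seteqP; split=> z /=; rewrite !in_itv/= ltr_pdivrMl// ler_pdivlMl.
rewrite /= !lebesgue_measure_itv/= !lte_fin ltr_pM2l ?invr_gt0//.
case: ifP => // _; rewrite ?mule0// -!EFinB -EFinM; congr (_%:E).
by field; rewrite gt_eqF.
Qed.

Lemma integral_oppr (f : R -> \bar R) :
  measurable_fun [set: R] f -> (forall x, 0 <= f x)%E ->
  (\int[mu]_x f (- x)%R = \int[mu]_x f x)%E.
Proof.
move=> mf f0.
pose phi := (fun x : measurableTypeR R => - x : measurableTypeR R).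
have mphi : measurable_fun [set: measurableTypeR R] phi.
  exact: (@measurable_funN _ R R).
rewrite -[LHS](@ge0_integral_pushforward _ _ _ _ _ phi mphi mu setT f)//.
by apply: eq_measure_integral => A mA _; exact: lebesgue_measureN.
Qed.

End lebesgue_affine.

(** * Iterated Gaussian integrals: measurability, linearity, countable sums *)

Section gauss_int_theory.
Context {R : realType} (s : R).
Local Notation mu := (@lebesgue_measure R).
Local Open Scope ereal_scope.

Lemma measurable_cons_tuple d (T : measurableType d) n (g : T -> R)
    (h : T -> n.-tuple R) :
  measurable_fun setT g -> measurable_fun setT h ->
  measurable_fun setT (fun t => cons_tuple (g t) (h t)).
Proof. by move=> mg mh; exact: measurable_cons. Qed.

Lemma measurable_fun_cons_tuple n (f : n.+1.-tuple R -> \bar R) (x : R) :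
  measurable_fun setT f -> measurable_fun setT (fun y => f (cons_tuple x y)).
Proof. by move=> mf; apply: measurableT_comp => //; apply: measurable_cons_tuple. Qed.

Lemma gauss_int_ge0 n (f : n.-tuple R -> \bar R) :
  (forall y, 0 <= f y) -> 0 <= gauss_int s f.
Proof.
elim: n f => [|n IH] f f0 //=; apply: integral_ge0 => x _.
by rewrite mule_ge0 ?lee_fin ?normal_pdf_ge0 ?IH.
Qed.

(** The induction moves each integration variable into the parameter, so the parameter space [T]
    must be arbitrary. The measurability half of Tonelli's theorem then handles the outer
    integral. *)
Lemma measurable_fun_gauss_int n d (T : measurableType d)
    (f : T * n.-tuple R -> \bar R) :
  measurable_fun setT f -> (forall z, 0 <= f z) ->
  measurable_fun setT (fun t => gauss_int s (fun y => f (t, y))).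
Proof.
elim: n d T f => [|n IH] d T f mf f0 /=; first exact: measurableT_comp.
apply: (@measurable_fun_fubini_tonelli_F _ _ T (measurableTypeR R) R mu (fun z =>
  (normal_pdf 0 s z.2)%:E * gauss_int s (fun y => f (z.1, cons_tuple z.2 y)))).
  apply: emeasurable_funM.
    apply/measurable_EFinP; apply: (@measurableT_comp _ _ _ _ R) => //.
    exact: measurable_normal_pdf.
  apply: (IH _ (T * measurableTypeR R)%type
    (fun w => f (w.1.1, cons_tuple w.1.2 w.2))) => //.
  apply: measurableT_comp => //; apply: measurable_fun_pair => /=.
    exact: (measurableT_comp measurable_fst measurable_fst).
  apply: measurable_cons_tuple => //.
  exact: (measurableT_comp measurable_snd measurable_fst).
by move=> z; rewrite mule_ge0 ?lee_fin ?normal_pdf_ge0 ?gauss_int_ge0.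
Qed.

Lemma measurable_fun_gauss_int_cons n (f : n.+1.-tuple R -> \bar R) :
  measurable_fun setT f -> (forall y, 0 <= f y) ->
  measurable_fun [set: R] (fun x => gauss_int s (fun y => f (cons_tuple x y))).
Proof.
move=> mf f0.
apply: (@measurable_fun_gauss_int n _ R (fun z => f (cons_tuple z.1 z.2))) => //.
by apply: measurableT_comp => //; exact: measurable_cons_tuple.
Qed.

Lemma measurable_normal_gauss_int n (f : n.+1.-tuple R -> \bar R) :
  measurable_fun setT f -> (forall y, 0 <= f y) ->
  measurable_fun [set: R]
    (fun x => (normal_pdf 0 s x)%:E * gauss_int s (fun y => f (cons_tuple x y))).
Proof.
move=> mf f0; apply: emeasurable_funM; last exact: measurable_fun_gauss_int_cons.
by apply/measurable_EFinP; exact: measurable_normal_pdf.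
Qed.

Lemma le_gauss_int n (f g : n.-tuple R -> \bar R) :
  measurable_fun setT f -> measurable_fun setT g ->
  (forall y, 0 <= f y) -> (forall y, f y <= g y) ->
  gauss_int s f <= gauss_int s g.
Proof.
elim: n f g => [|n IH] f g mf mg f0 fg //=.
have g0 y : 0 <= g y by exact: le_trans (fg y).
apply: ge0_le_integral => //.
- by move=> x _; rewrite mule_ge0 ?lee_fin ?normal_pdf_ge0 ?gauss_int_ge0.
- exact: measurable_normal_gauss_int.
- exact: measurable_normal_gauss_int.
- move=> x _; apply: lee_wpmul2l; first by rewrite lee_fin normal_pdf_ge0.
  by apply: IH => //; exact: measurable_fun_cons_tuple.
Qed.

Lemma gauss_intD n (f g : n.-tuple R -> \bar R) :
  measurable_fun setT f -> measurable_fun setT g ->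
  (forall y, 0 <= f y) -> (forall y, 0 <= g y) ->
  gauss_int s (fun y => f y + g y) = gauss_int s f + gauss_int s g.
Proof.
elim: n f g => [|n IH] f g mf mg f0 g0 //=.
rewrite -ge0_integralD//; first last.
- exact: measurable_normal_gauss_int.
- by move=> x _; rewrite mule_ge0 ?lee_fin ?normal_pdf_ge0 ?gauss_int_ge0.
- exact: measurable_normal_gauss_int.
- by move=> x _; rewrite mule_ge0 ?lee_fin ?normal_pdf_ge0 ?gauss_int_ge0.
apply: eq_integral => x _.
rewrite IH//; try exact: measurable_fun_cons_tuple.
by rewrite ge0_muleDr ?gauss_int_ge0.
Qed.

Lemma gauss_intZl n (k : R) (f : n.-tuple R -> \bar R) : (0 <= k)%R ->
  measurable_fun setT f -> (forall y, 0 <= f y) ->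
  gauss_int s (fun y => k%:E * f y) = k%:E * gauss_int s f.
Proof.
move=> k0; elim: n f => [|n IH] f mf f0 //=.
rewrite -ge0_integralZl_EFin//; first last.
- exact: measurable_normal_gauss_int.
- by move=> x _; rewrite mule_ge0 ?lee_fin ?normal_pdf_ge0 ?gauss_int_ge0.
apply: eq_integral => x _; rewrite IH//; first by rewrite muleCA.
exact: measurable_fun_cons_tuple.
Qed.

Lemma gauss_int_cst n (k : R) : (0 <= k)%R ->
  gauss_int s (fun _ : n.-tuple R => k%:E) = k%:E.
Proof.
move=> k0; elim: n => [|n IH] //=.
under eq_integral do rewrite IH muleC.
rewrite ge0_integralZl_EFin//; first by rewrite integral_normal_pdf mule1.
- by move=> x _; rewrite lee_fin normal_pdf_ge0.
- by apply/measurable_EFinP; exact: measurable_normal_pdf.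
Qed.

Lemma gauss_int_nneseries n (f : (n.-tuple R -> \bar R)^nat) :
  (forall i, measurable_fun setT (f i)) -> (forall i y, 0 <= f i y) ->
  gauss_int s (fun y => \sum_(i <oo) f i y) = \sum_(i <oo) gauss_int s (f i).
Proof.
elim: n f => [|n IH] f mf f0 //=.
rewrite -integral_nneseries//; first last.
- by move=> i x _; rewrite mule_ge0 ?lee_fin ?normal_pdf_ge0 ?gauss_int_ge0.
- by move=> i; exact: measurable_normal_gauss_int.
apply: eq_integral => x _.
rewrite nneseriesZl//; last by move=> i _; exact: gauss_int_ge0.
rewrite IH// => i; exact: measurable_fun_cons_tuple.
Qed.

End gauss_int_theory.

(** * The Gaussian law as a probability measure *)

Section gauss_prob_measure.
Context {R : realType} (s : R) (n : nat).
Local Open Scope ereal_scope.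

Lemma measurable_EFin_indic (A : set (n.-tuple R)) : measurable A ->
  measurable_fun setT (fun y => (\1_A y : R)%:E).
Proof. by move=> mA; apply/measurable_EFinP; exact: measurable_indic. Qed.

Let gauss_prob0 : gauss_prob s (@set0 (n.-tuple R)) = 0.
Proof. by rewrite /gauss_prob indic0 gauss_int_cst. Qed.

Let gauss_prob_ge0 (A : set (n.-tuple R)) : 0 <= gauss_prob s A.
Proof. by apply: gauss_int_ge0 => y; rewrite lee_fin. Qed.

Let gauss_prob_sigma_additive :
  semi_sigma_additive (@gauss_prob R s n).
Proof.
move=> F mF tF mUF.
rewrite [X in _ --> X](_ : _ = \sum_(i <oo) gauss_prob s (F i)); last first.
  rewrite /gauss_prob -gauss_int_nneseries; last 2 first.
  - by move=> i; exact: measurable_EFin_indic.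
  - by move=> i y; rewrite lee_fin.
  by congr (gauss_int s _); apply/funext => y; rewrite indic_bigcup.
exact: is_cvg_ereal_nneg_natsum.
Qed.

HB.instance Definition _ := isMeasure.Build _ _ _ (@gauss_prob R s n)
  gauss_prob0 gauss_prob_ge0 gauss_prob_sigma_additive.

Let gauss_prob_setT : gauss_prob s [set: n.-tuple R] = 1.
Proof. by rewrite /gauss_prob indicT gauss_int_cst. Qed.

HB.instance Definition _ :=
  @Measure_isProbability.Build _ _ R (@gauss_prob R s n) gauss_prob_setT.

End gauss_prob_measure.

(** * Mean shifts of the Gaussian measure *)

Section linear_functionals.
Context {R : realType}.

Definition dotp n (a : 'I_n -> R) (u : n.-tuple R) : R :=
  \sum_(i < n) a i * tnth u i.

Definition sumsq n (a : 'I_n -> R) : R := \sum_(i < n) (a i) ^+ 2.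

Definition shift_tuple n (m : 'I_n -> R) (u : n.-tuple R) : n.-tuple R :=
  [tuple m i + tnth u i | i < n].

Lemma sumsq_ge0 n (a : 'I_n -> R) : 0 <= sumsq a.
Proof. by apply: sumr_ge0 => i _; exact: sqr_ge0. Qed.

Lemma dotp_cons n (a : 'I_n.+1 -> R) x u :
  dotp a (cons_tuple x u) = a ord0 * x + dotp (a \o lift ord0) u.
Proof.
rewrite /dotp big_ord_recl tnth0; congr +%R.
by apply: eq_bigr => i _; rewrite tnthS.
Qed.

Lemma sumsq_recl n (a : 'I_n.+1 -> R) :
  sumsq a = a ord0 ^+ 2 + sumsq (a \o lift ord0).
Proof. by rewrite /sumsq big_ord_recl. Qed.

Lemma shift_tuple_cons n (m : 'I_n.+1 -> R) x u :
  shift_tuple m (cons_tuple x u) =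
  cons_tuple (m ord0 + x) (shift_tuple (m \o lift ord0) u).
Proof.
apply: eq_from_tnth => i; rewrite tnth_mktuple.
by case: (unliftP ord0 i) => [j|] ->; rewrite ?tnth0 ?tnthS ?tnth_mktuple.
Qed.

Lemma measurable_dotp n (a : 'I_n -> R) : measurable_fun setT (dotp a).
Proof.
apply: measurable_sum => i; apply: measurable_funM => //.
exact: measurable_tnth.
Qed.

Lemma measurable_shift_tuple n (m : 'I_n -> R) :
  measurable_fun setT (shift_tuple m).
Proof.
apply/measurable_fun_tnthP => i /=.
rewrite (_ : _ \o _ = fun u => m i + tnth u i); last first.
  by apply/funext => u /=; rewrite tnth_mktuple.
by apply: measurable_funD => //; exact: measurable_tnth.
Qed.

End linear_functionals.

(** * Likelihood ratios: contiguity, total variation, exponential tails *)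

Section cameron_martin.
Context {R : realType} (s : R) (s0 : 0 < s).
Local Notation mu := (@lebesgue_measure R).

(** The density of N(m, s^2 I) with respect to N(0, s^2 I). *)
Definition lik n (m : 'I_n -> R) (u : n.-tuple R) : R :=
  expR (dotp m u / s ^+ 2 - sumsq m / (s ^+ 2 *+ 2)).

Lemma lik_ge0 n (m : 'I_n -> R) u : 0 <= lik m u.
Proof. exact: expR_ge0. Qed.

Lemma measurable_lik n (m : 'I_n -> R) : measurable_fun setT (lik m).
Proof.
apply: measurableT_comp => //; apply: measurable_funB => //.
by apply: measurable_funM => //; exact: measurable_dotp.
Qed.

Lemma lik_cons n (m : 'I_n.+1 -> R) x u :
  lik m (cons_tuple x u) =
  expR (m ord0 * x / s ^+ 2 - m ord0 ^+ 2 / (s ^+ 2 *+ 2)) *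
  lik (m \o lift ord0) u.
Proof.
rewrite /lik -expRD dotp_cons sumsq_recl; congr expR.
by field; rewrite gt_eqF.
Qed.

Lemma normal_pdf_shift (a x : R) :
  normal_pdf 0 s (x - a) =
  normal_pdf 0 s x * expR (a * x / s ^+ 2 - a ^+ 2 / (s ^+ 2 *+ 2)).
Proof.
rewrite normal_pdfE ?gt_eqF//= -[RHS]mulrA /normal_fun -expRD; congr (_ * expR _).
by field; rewrite gt_eqF.
Qed.

Local Open Scope ereal_scope.

(** The Cameron-Martin formula, one coordinate at a time: translating the first variable moves the
    shift into its density, which yields the first factor of [lik]. *)
Lemma gauss_int_shift n (m : 'I_n -> R) (f : n.-tuple R -> \bar R) :
  measurable_fun setT f -> (forall u, 0 <= f u) ->
  gauss_int s (fun u => f (shift_tuple m u)) =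
  gauss_int s (fun u => (lik m u)%:E * f u).
Proof.
elim: n m f => [|n IH] m f mf f0 /=.
  rewrite /lik /dotp /sumsq !big_ord0 !mul0r subr0 expR0 mul1e.
  by rewrite (tuple0 (shift_tuple _ _)).
pose G x := gauss_int s (fun y => (lik (m \o lift ord0) y)%:E * f (cons_tuple x y)).
have mLf : measurable_fun setT
    (fun z : R * n.-tuple R => (lik (m \o lift ord0) z.2)%:E * f (cons_tuple z.1 z.2)).
  apply: emeasurable_funM.
    apply/measurable_EFinP; apply: measurableT_comp => //; exact: measurable_lik.
  by apply: measurableT_comp => //; exact: measurable_cons_tuple.
have mG : measurable_fun [set: R] G.
  apply: (measurable_fun_gauss_int s mLf) => z.
  by rewrite mule_ge0 ?lee_fin ?lik_ge0.
have G0 x : 0 <= G x.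
  by apply: gauss_int_ge0 => y; rewrite mule_ge0 ?lee_fin ?lik_ge0.
transitivity (\int[mu]_x ((normal_pdf 0 s x)%:E * G (m ord0 + x)%R)).
  apply: eq_integral => x _; congr (_ * _).
  rewrite (_ : (fun y => _) = fun y => f (cons_tuple (m ord0 + x)%R
    (shift_tuple (m \o lift ord0) y))); last first.
    by apply/funext => y; rewrite shift_tuple_cons.
  by rewrite (IH _ (fun y => f (cons_tuple (m ord0 + x)%R y)))//;
    exact: measurable_fun_cons_tuple.
pose h x := (normal_pdf 0 s (x - m ord0)%R)%:E * G x.
transitivity (\int[mu]_x h (x + m ord0)%R).
  by apply: eq_integral => x _; rewrite /h addrK addrC.
rewrite integral_translation; first last.
- by move=> x; rewrite /h mule_ge0 ?lee_fin ?normal_pdf_ge0.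
- apply: emeasurable_funM => //; apply/measurable_EFinP.
  apply: measurableT_comp; first exact: measurable_normal_pdf.
  exact: measurable_funB.
apply: eq_integral => x _; rewrite /h normal_pdf_shift EFinM -muleA; congr (_ * _).
rewrite -gauss_intZl ?expR_ge0//; first last.
- by move=> y; rewrite mule_ge0 ?lee_fin ?lik_ge0.
- exact: (measurableT_comp mLf (measurable_fun_pair (measurable_cst x) (@measurable_id _ _ _))).
congr gauss_int; apply/funext => y.
by rewrite lik_cons EFinM muleA.
Qed.

Lemma gauss_prob_shift n (m : 'I_n -> R) (A : set (n.-tuple R)) : measurable A ->
  gauss_prob s (shift_tuple m @^-1` A) =
  gauss_int s (fun u => (lik m u * \1_A u)%:E).
Proof.
move=> mA; rewrite /gauss_prob.
rewrite (_ : (fun u => _) = fun u => (\1_A (shift_tuple m u) : R)%:E)//.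
rewrite (@gauss_int_shift _ _ (fun u => (\1_A u)%:E))//.
exact: measurable_EFin_indic.
Qed.

Lemma gauss_int_lik n (m : 'I_n -> R) : gauss_int s (fun u => (lik m u)%:E) = 1.
Proof.
rewrite -(gauss_int_cst s n ler01) (@gauss_int_shift _ m (fun=> 1%:E))//.
by congr (gauss_int s _); apply/funext => u; rewrite mule1.
Qed.

(** Up to a constant factor, the square of the density for [m] is the density for [2 m], which
    integrates to 1. *)
Lemma gauss_int_lik2 n (m : 'I_n -> R) :
  gauss_int s (fun u => (lik m u ^+ 2)%:E) = (expR (sumsq m / s ^+ 2))%:E.
Proof.
pose m2 i := (2 * m i)%R.
rewrite (_ : (fun u => _) =
  fun u => (expR (sumsq m / s ^+ 2))%:E * (lik m2 u)%:E).
  rewrite gauss_intZl ?expR_ge0 ?gauss_int_lik ?mule1//.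
  - by apply/measurable_EFinP; exact: measurable_lik.
  - by move=> u; rewrite lee_fin lik_ge0.
apply/funext => u; rewrite -EFinM /lik -expRM_natl -expRD; congr (expR _)%:E.
have -> : dotp m2 u = (2 * dotp m u)%R.
  by rewrite /dotp mulr_sumr; apply: eq_bigr => i _; rewrite mulrA.
have -> : sumsq m2 = (4 * sumsq m)%R.
  rewrite /sumsq mulr_sumr; apply: eq_bigr => i _.
  by rewrite exprMn; congr *%R; rewrite -natrX.
by field; rewrite gt_eqF.
Qed.

(** Pointwise, the likelihood ratio [L] satisfies [L 1_A <= c 1_A + L^2 / c], and the last term is
    integrated by the second-moment formula. *)
Lemma gauss_prob_shift_contiguity n (m : 'I_n -> R) (A : set (n.-tuple R)) (c : R) :
  measurable A -> (0 < c)%R ->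
  gauss_prob s (shift_tuple m @^-1` A) <=
  c%:E * gauss_prob s A + (expR (sumsq m / s ^+ 2) / c)%:E.
Proof.
move=> mA c0; rewrite gauss_prob_shift//.
have mL2 : measurable_fun setT (fun u => (lik m u ^+ 2)%:E).
  by apply/measurable_EFinP; apply: measurable_funX; exact: measurable_lik.
rewrite [X in _ + X](_ : _ = c^-1%:E * gauss_int s (fun u => (lik m u ^+ 2)%:E)).
  have -> : c%:E * gauss_prob s A = gauss_int s (fun u => c%:E * (\1_A u)%:E).
    by rewrite gauss_intZl ?(ltW c0)//; exact: measurable_EFin_indic.
  rewrite -gauss_intZl ?invr_ge0 ?(ltW c0)//; last first.
    by move=> u; rewrite lee_fin sqr_ge0.
  rewrite -gauss_intD; first last.
  - by move=> u; rewrite -EFinM lee_fin mulr_ge0 ?invr_ge0 ?sqr_ge0 ?ltW.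
  - by move=> u; rewrite -EFinM lee_fin mulr_ge0 ?(ltW c0).
  - by apply: emeasurable_funM.
  - by apply: emeasurable_funM => //; exact: measurable_EFin_indic.
  apply: le_gauss_int.
  - apply/measurable_EFinP; apply: measurable_funM; first exact: measurable_lik.
    exact: measurable_indic.
  - apply: emeasurable_funD; apply: emeasurable_funM => //.
    exact: measurable_EFin_indic.
  - by move=> u; rewrite lee_fin mulr_ge0 ?lik_ge0.
  move=> u; rewrite -!EFinM -EFinD lee_fin indicE.
  have L0 := lik_ge0 m u.
  have LL : (lik m u * c <= c ^+ 2 + lik m u ^+ 2)%R by nra.
  case: (u \in A) => /=; last by rewrite !mulr0 add0r mulr_ge0 ?invr_ge0 ?sqr_ge0 ?ltW.
  rewrite !mulr1 -(ler_pM2r c0) mulrDl mulrAC mulVf ?gt_eqF// mul1r.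
  by rewrite -expr2.
by rewrite gauss_int_lik2 -EFinM mulrC.
Qed.

(** Pointwise [L - 1 <= c + (L - 1)^2 / (4 c)], and [(L - 1)^2] has integral [exp(|m|^2 / s^2) - 1].
    The free constant [c] balances the two terms. *)
Lemma gauss_prob_shift_tv n (m : 'I_n -> R) (A : set (n.-tuple R)) (c : R) :
  measurable A -> (0 < c)%R ->
  gauss_prob s (shift_tuple m @^-1` A) <=
  gauss_prob s A + (c + (expR (sumsq m / s ^+ 2) - 1) / (4 * c))%:E.
Proof.
move=> mA c0; rewrite gauss_prob_shift//.
have c4 : (0 < 4 * c)%R by rewrite mulr_gt0.
have mL : measurable_fun setT (fun u => (lik m u)%:E).
  by apply/measurable_EFinP; exact: measurable_lik.
pose K u := ((lik m u - 1) ^+ 2 / (4 * c))%R.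
have K0 u : (0 <= K u)%R by rewrite /K mulr_ge0 ?sqr_ge0 ?invr_ge0 ?ltW.
have mK : measurable_fun setT (fun u => (K u)%:E).
  apply/measurable_EFinP; apply: measurable_funM => //; apply: measurable_funX.
  by apply: measurable_funB => //; exact: measurable_lik.
have EK : gauss_int s (fun u => (K u)%:E) =
    ((expR (sumsq m / s ^+ 2) - 1) / (4 * c))%:E.
  (* Expanding the square gives a negative cross term, while [gauss_intD] asks for nonnegative
     integrands; adding [L / (2 c)], of integral [1 / (2 c)], removes it. *)
  have : gauss_int s (fun u => (K u)%:E) + (2 * c)^-1%:E =
      ((expR (sumsq m / s ^+ 2) + 1) / (4 * c))%:E.
    rewrite -[X in _ + X]mule1 -(gauss_int_lik m) -gauss_intZl//; last 2 first.
    - by rewrite invr_ge0 mulr_ge0 ?ltW.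
    - by move=> u; rewrite lee_fin lik_ge0.
    rewrite -gauss_intD//; last 2 first.
    - exact: emeasurable_funM.
    - by move=> u; rewrite -EFinM lee_fin mulr_ge0 ?lik_ge0 ?invr_ge0 ?mulr_ge0 ?ltW.
    rewrite (_ : (fun u => _) = fun u =>
      (4 * c)^-1%:E * ((lik m u ^+ 2)%:E + 1)); last first.
      apply/funext => u; rewrite -EFinM -!EFinD; congr (_%:E).
      by rewrite /K; field; rewrite gt_eqF.
    have mL2 : measurable_fun setT (fun u => (lik m u ^+ 2)%:E).
      by apply/measurable_EFinP; apply: measurable_funX; exact: measurable_lik.
    rewrite gauss_intZl ?invr_ge0 ?(ltW c4)//; last 2 first.
    - exact: emeasurable_funD.
    - by move=> u; rewrite adde_ge0 ?lee_fin ?sqr_ge0.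
    rewrite (@gauss_intD _ _ _ _ (fun=> 1))//; last by move=> u; rewrite lee_fin sqr_ge0.
    by rewrite gauss_int_lik2 gauss_int_cst// -EFinD -EFinM mulrC.
  move=> EK; rewrite -(addeK (gauss_int s (fun u => (K u)%:E)) (x := (2 * c)^-1%:E))// EK -EFinB.
  by congr (_%:E); field; rewrite gt_eqF.
rewrite EFinD -EK addeA -[X in _ + X + _](gauss_int_cst s n (ltW c0)).
rewrite /gauss_prob -gauss_intD//; last 2 first.
- exact: measurable_EFin_indic.
- by move=> u; rewrite lee_fin ltW.
rewrite -gauss_intD//; last 2 first.
- by apply: emeasurable_funD => //; exact: measurable_EFin_indic.
- by move=> u; rewrite -EFinD lee_fin addr_ge0// ltW.
apply: le_gauss_int.
- apply/measurable_EFinP; apply: measurable_funM; first exact: measurable_lik.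
  exact: measurable_indic.
- by do 2 apply: emeasurable_funD => //; exact: measurable_EFin_indic.
- by move=> u; rewrite lee_fin mulr_ge0 ?lik_ge0.
move=> u; rewrite -!EFinD lee_fin indicE.
case: (u \in A) => /=; last by rewrite !mulr0 add0r addr_ge0// ltW.
have KE : (K u * (4 * c) = (lik m u - 1) ^+ 2)%R by rewrite /K divfK ?gt_eqF.
have := sqr_ge0 (lik m u - 1 - 2 * c)%R.
rewrite -(ler_pM2r c4). move: KE; set k := K u; nra.
Qed.

(** Chernoff's bound with the tilt [lik a]: on the event, [lik a u] is at least the reciprocal of
    the right-hand side, and its mean is 1. *)
Lemma gauss_prob_dotp_gt n (a : 'I_n -> R) (M : R) :
  gauss_prob s [set u | (M < dotp a u)%R] <=
  (expR ((sumsq a / 2 - M) / s ^+ 2))%:E.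
Proof.
have mA : measurable [set u : n.-tuple R | (M < dotp a u)%R].
  rewrite -[X in measurable X]setTI.
  by apply: measurable_fun_ltr => //; exact: measurable_dotp.
have mL : measurable_fun setT (fun u => (lik a u)%:E).
  by apply/measurable_EFinP; exact: measurable_lik.
rewrite -[leRHS]mule1 -(gauss_int_lik a) -gauss_intZl ?expR_ge0//; last first.
  by move=> u; rewrite lee_fin lik_ge0.
apply: le_gauss_int.
- exact: measurable_EFin_indic.
- exact: emeasurable_funM.
- by move=> u; rewrite lee_fin.
move=> u; rewrite -EFinM lee_fin indicE.
have [|_] := boolP (u \in _); last by rewrite mulr_ge0 ?expR_ge0.
rewrite inE/= => Mu; rewrite /lik -expRD (le_trans _ (expR_ge1Dx _))// lerDl.
have -> : ((sumsq a / 2 - M) / s ^+ 2 +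
  (dotp a u / s ^+ 2 - sumsq a / (s ^+ 2 *+ 2)) =
  (dotp a u - M) / s ^+ 2)%R by field; rewrite gt_eqF.
by rewrite divr_ge0 ?sqr_ge0// subr_ge0 ltW.
Qed.

End cameron_martin.

(** * One-dimensional marginals *)

Section normal_law.
Context {R : realType}.
Local Notation mu := (@lebesgue_measure R).

Lemma normal_peakE (s : R) : 0 < s -> normal_peak s = (Num.sqrt (pi *+ 2))^-1 / s.
Proof.
move=> s0; rewrite /normal_peak -mulrnAr sqrtrM ?sqr_ge0// sqrtr_sqr gtr0_norm//.
by rewrite invfM mulrC.
Qed.

Lemma normal_pdf_scale (a s x : R) : 0 < a -> 0 < s ->
  a * normal_pdf 0 (a * s) (a * x) = normal_pdf 0 s x.
Proof.
move=> a0 s0; have as0 : 0 < a * s by rewrite mulr_gt0.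
rewrite !normal_pdfE ?gt_eqF//= !normal_peakE// mulrA; congr (_ * expR _).
  by field; rewrite ?gt_eqF// sqrtr_gt0 mulrn_wgt0// pi_gt0.
by field; rewrite !gt_eqF.
Qed.

Lemma normal_pdf_opp (s x : R) : normal_pdf 0 s x = normal_pdf 0 s (- x) \/ s = 0.
Proof.
have [->|s0] := eqVneq s 0; [by right|left].
by rewrite !normal_pdfE//= /normal_fun !subr0 sqrrN.
Qed.

(* Completing the square in x. *)
Lemma normal_pdf_mul (a s t : R) (x z : R) : 0 < s -> 0 < t ->
  let T := Num.sqrt (t ^+ 2 + a ^+ 2 * s ^+ 2) in
  normal_pdf 0 s x * normal_pdf 0 t (z - a * x) =
  normal_pdf 0 T z * normal_pdf 0 (s * t / T) (x - a * s ^+ 2 / T ^+ 2 * z).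
Proof.
move=> s0 t0 T.
have as_ge0 : 0 <= a ^+ 2 * s ^+ 2 by rewrite -exprMn sqr_ge0.
have T2 : T ^+ 2 = t ^+ 2 + a ^+ 2 * s ^+ 2.
  by rewrite sqr_sqrtr// addr_ge0// sqr_ge0.
have T0 : 0 < T by rewrite sqrtr_gt0 ltr_wpDr// exprn_gt0.
have st0 : 0 < s * t / T by rewrite divr_gt0 ?mulr_gt0.
rewrite !normal_pdfE ?gt_eqF//= !normal_peakE//.
set C := Num.sqrt _; have C0 : 0 < C by rewrite sqrtr_gt0 mulrn_wgt0// pi_gt0.
rewrite [LHS]mulrACA [RHS]mulrACA; congr (_ * _).
  by field; rewrite !gt_eqF.
rewrite /normal_fun -!expRD; congr expR.
rewrite !subr0.
have sn0 : s != 0 by rewrite gt_eqF.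
have tn0 : t != 0 by rewrite gt_eqF.
have Tn0 : T != 0 by rewrite gt_eqF.
have -> : - x ^+ 2 / (s ^+ 2 *+ 2) + - (z - a * x) ^+ 2 / (t ^+ 2 *+ 2) =
  - (x ^+ 2 * (t ^+ 2 + a ^+ 2 * s ^+ 2) - 2 * a * s ^+ 2 * x * z + s ^+ 2 * z ^+ 2)
    / (2 * s ^+ 2 * t ^+ 2) by field; rewrite ?sn0 ?tn0.
rewrite -T2.
have -> : - z ^+ 2 / (T ^+ 2 *+ 2) +
  - (x - a * s ^+ 2 / T ^+ 2 * z) ^+ 2 / ((s * t / T) ^+ 2 *+ 2) =
  - (x ^+ 2 * T ^+ 2 - 2 * a * s ^+ 2 * x * z
     + (s ^+ 2 * (t ^+ 2 + a ^+ 2 * s ^+ 2)) / T ^+ 2 * z ^+ 2) / (2 * s ^+ 2 * t ^+ 2).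
  by field; rewrite ?sn0 ?tn0 ?Tn0.
by rewrite -T2 mulfK// expf_neq0.
Qed.

Local Open Scope ereal_scope.

Let mpdf (s : R) (f : R -> R) : measurable_fun [set: R] f ->
  measurable_fun [set: R] (fun x => (normal_pdf 0 s x * f x)%:E).
Proof.
move=> mf; apply/measurable_EFinP; apply: measurable_funM => //.
exact: measurable_normal_pdf.
Qed.

Lemma integral_normal_scale (a s : R) (f : R -> R) : (0 < s)%R -> a != 0%R ->
  measurable_fun [set: R] f -> (forall x, 0 <= f x)%R ->
  \int[mu]_x (normal_pdf 0 s x * f (a * x))%:E =
  \int[mu]_z (normal_pdf 0 (`|a| * s) z * f z)%:E.
Proof.
move=> s0; wlog a0 : a f / (0 < a)%R => [wlg an0 mf f0|_ mf f0].
  have [a0|a0|/eqP] := ltgtP a 0%R; [|exact: wlg|by rewrite (negbTE an0)].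
  have mf' : measurable_fun [set: R] (f \o -%R) by exact: measurableT_comp.
  have := wlg (- a)%R (f \o -%R); rewrite oppr_gt0 oppr_eq0 normrN => /(_ a0 an0 mf').
  have f0' x : (0 <= (f \o -%R) x)%R by exact: f0.
  move=> /(_ f0') E; transitivity
    (\int[mu]_x (normal_pdf 0 s x * (f \o -%R) (- a * x))%:E).
    by apply: eq_integral => x _ /=; rewrite mulNr opprK.
  rewrite E -integral_oppr; first last.
  - by move=> x; rewrite lee_fin mulr_ge0 ?normal_pdf_ge0.
  - exact: mpdf.
  apply: eq_integral => x _ /=; rewrite opprK.
  by have [<-//|/eqP] := normal_pdf_opp (`|a| * s) x; rewrite mulf_eq0 normr_eq0 (negbTE an0) gt_eqF.
rewrite gtr0_norm// -(@integral_scaling _ a (fun z => (normal_pdf 0 (a * s) z * f z)%:E) a0);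
  first last.
- by move=> x; rewrite lee_fin mulr_ge0 ?normal_pdf_ge0.
- exact: mpdf.
rewrite -ge0_integralZl_EFin ?(ltW a0)//; first last.
- apply/measurable_EFinP; apply: measurable_funM; last first.
    by apply: measurableT_comp => //; exact: measurable_funM.
  apply: (measurableT_comp (measurable_normal_pdf _ _)); exact: measurable_funM.
- by move=> x _; rewrite lee_fin mulr_ge0 ?normal_pdf_ge0.
by apply: eq_integral => x _; rewrite -EFinM mulrA normal_pdf_scale.
Qed.

(** Replacing [z] by [z - a x], exchanging the integrals and completing the square leaves a normal
    density in [x], which integrates to 1. *)
Lemma integral_normal_convolution (a s t : R) (f : R -> R) :
  (0 < s)%R -> (0 < t)%R ->
  measurable_fun [set: R] f -> (forall x, 0 <= f x)%R ->
  \int[mu]_x ((normal_pdf 0 s x)%:E *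
     \int[mu]_z (normal_pdf 0 t z * f (a * x + z))%:E) =
  \int[mu]_z (normal_pdf 0 (Num.sqrt (t ^+ 2 + a ^+ 2 * s ^+ 2)) z * f z)%:E.
Proof.
move=> s0 t0 mf f0; set T := Num.sqrt _.
pose g (w : measurableTypeR R * measurableTypeR R) :=
  (normal_pdf 0 s w.1 * (normal_pdf 0 t (w.2 - a * w.1) * f w.2))%:E.
have mfst : measurable_fun setT (fun w : measurableTypeR R * measurableTypeR R => w.1 : R).
  exact: measurable_fst.
have msnd : measurable_fun setT (fun w : measurableTypeR R * measurableTypeR R => w.2 : R).
  exact: measurable_snd.
have mg : measurable_fun setT g.
  apply/measurable_EFinP; apply: measurable_funM.
    exact: (measurableT_comp (measurable_normal_pdf _ _)).
  apply: measurable_funM; last exact: (measurableT_comp mf).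
  apply: (measurableT_comp (measurable_normal_pdf _ _)).
  by apply: measurable_funB => //; exact: measurable_funM.
have g0 w : 0 <= g w by rewrite lee_fin !mulr_ge0 ?normal_pdf_ge0.
transitivity (\int[mu]_x \int[mu]_z g (x, z)).
  apply: eq_integral => x _.
  rewrite -ge0_integralZl_EFin ?normal_pdf_ge0//; first last.
  - by apply: mpdf; apply: measurableT_comp => //; exact: measurable_funD.
  - by move=> z _; rewrite lee_fin mulr_ge0 ?normal_pdf_ge0.
  rewrite -[RHS](integral_translation (a * x)%R); first last.
  - by move=> z; exact: g0.
  - exact: (measurableT_comp mg (measurable_fun_pair (measurable_cst x) (@measurable_id _ _ _))).
  by apply: eq_integral => z _; rewrite /g/= addrK -EFinM addrC.
rewrite (@fubini_tonelli _ _ _ _ _ mu mu g)//.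
apply: eq_integral => z _.
pose r := (s * t / T)%R.
transitivity (\int[mu]_x ((normal_pdf 0 T z * f z)%:E *
    (normal_pdf 0 r (x + - (a * s ^+ 2 / T ^+ 2 * z)))%:E)).
  apply: eq_integral => x _; rewrite /g/= -EFinM mulrA normal_pdf_mul//.
  by rewrite -/T -/r mulrAC.
rewrite ge0_integralZl_EFin ?mulr_ge0 ?normal_pdf_ge0//; first last.
- apply/measurable_EFinP; apply: (measurableT_comp (measurable_normal_pdf _ _)).
  exact: measurable_funD.
- by move=> x _; rewrite lee_fin normal_pdf_ge0.
rewrite (@integral_translation _ _ (fun x => (normal_pdf 0 r x)%:E)); first last.
- by move=> x; rewrite lee_fin normal_pdf_ge0.
- by apply/measurable_EFinP; exact: measurable_normal_pdf.
by rewrite integral_normal_pdf mule1.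
Qed.

Lemma gauss_int_dotp (s : R) n (a : 'I_n -> R) (f : R -> R) :
  (0 < s)%R -> (0 < sumsq a)%R ->
  measurable_fun [set: R] f -> (forall x, 0 <= f x)%R ->
  gauss_int s (fun u => (f (dotp a u))%:E) =
  \int[mu]_z (normal_pdf 0 (Num.sqrt (sumsq a) * s) z * f z)%:E.
Proof.
move=> s0; elim: n a f => [|n IH] a f a0 mf f0 /=.
  by move: a0; rewrite /sumsq big_ord0 ltxx.
pose b := a \o lift ord0.
(* If all remaining coefficients vanish, the rest of the sum is degenerate; the convolution lemma,
   which needs a positive standard deviation, is then replaced by scaling. *)
have [b0|b0] := eqVneq (sumsq b) 0%R; last first.
  have b1 : (0 < sumsq b)%R by rewrite lt_neqAle eq_sym b0 sumsq_ge0.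
  rewrite sumsq_recl -/b.
  transitivity (\int[mu]_x ((normal_pdf 0 s x)%:E * \int[mu]_z
      (normal_pdf 0 (Num.sqrt (sumsq b) * s) z * f (a ord0 * x + z))%:E)).
    apply: eq_integral => x _; congr (_ * _).
    rewrite (_ : (fun y => _) = fun y => (f (a ord0 * x + dotp b y))%:E); last first.
      by apply/funext => y; rewrite dotp_cons.
    rewrite (IH b (fun z => f (a ord0 * x + z)%R))//.
    by apply: measurableT_comp => //; exact: measurable_funD.
  rewrite integral_normal_convolution// ?mulr_gt0 ?sqrtr_gt0//.
  congr (\int[mu]_z (normal_pdf 0 _ z * f z)%:E).
  rewrite exprMn sqr_sqrtr ?sumsq_ge0// -mulrDl sqrtrM ?addr_ge0 ?sqr_ge0 ?sumsq_ge0//.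
  by rewrite sqrtr_sqr gtr0_norm// addrC.
have bi i : b i = 0%R.
  move/eqP: b0; rewrite psumr_eq0; last by move=> j _; exact: sqr_ge0.
  by move=> /allP/(_ i (mem_index_enum i))/=; rewrite sqrf_eq0 => /eqP.
have a00 : a ord0 != 0%R.
  by move: a0; rewrite sumsq_recl -/b b0 addr0 exprn_even_gt0.
rewrite sumsq_recl -/b b0 addr0 sqrtr_sqr -(@integral_normal_scale _ _ f s0 a00)//.
apply: eq_integral => x _; rewrite (_ : (fun y => _) = fun=> (f (a ord0 * x))%:E).
  by rewrite gauss_int_cst.
apply/funext => y; rewrite dotp_cons -/b /dotp big1 ?addr0// => i _.
by rewrite bi mul0r.
Qed.

Lemma gauss_prob_dotp_itv (s : R) n (a : 'I_n -> R) (x y : R) :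
  (0 < s)%R -> (0 < sumsq a)%R ->
  gauss_prob s [set u | (x < dotp a u <= y)%R] =
  \int[mu]_(z in `]x, y]) (normal_pdf 0 (Num.sqrt (sumsq a) * s) z)%:E.
Proof.
move=> s0 a0; rewrite /gauss_prob.
rewrite (_ : (fun u => _) = fun u => (\1_(`]x, y]) (dotp a u) : R)%:E); last first.
  apply/funext => u.
  have E : (u \in [set u | (x < dotp a u <= y)%R]) = (dotp a u \in `]x, y]%classic).
    by apply/idP/idP; rewrite !inE/= ?in_itv.
  by rewrite !indicE E.
rewrite (gauss_int_dotp s0 a0 (f := \1_(`]x, y]%classic)))//.
rewrite [RHS]integral_mkcond; apply: eq_integral => z _.
rewrite /= patchE indicE.
by case: ifPn => _; rewrite ?mulr1 ?mulr0.
Qed.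

End normal_law.

(** * Measurability of sets given by finitely many inequalities *)

Section measurable_comparisons.
Context {R : realType} d (T : measurableType d).

Lemma measurable_le_set (f g : T -> R) :
  measurable_fun setT f -> measurable_fun setT g ->
  measurable [set u | f u <= g u].
Proof.
move=> mf mg; rewrite -[X in measurable X]setTI.
by apply: measurable_fun_ler.
Qed.

Lemma measurable_lt_set (f g : T -> R) :
  measurable_fun setT f -> measurable_fun setT g ->
  measurable [set u | f u < g u].
Proof.
move=> mf mg; rewrite -[X in measurable X]setTI.
by apply: measurable_fun_ltr.
Qed.

Lemma measurable_forall_ord K (A : 'I_K -> set T) :
  (forall i, measurable (A i)) -> measurable [set u | forall i, A i u].
Proof.
move=> mA; rewrite (_ : mkset _ = \bigcap_(i in [set: 'I_K]) A i).
  exact: fin_bigcap_measurable.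
by apply/seteqP; split=> u /= h i; [move=> _|]; exact: h.
Qed.

Lemma measurable_exists_ord K (A : 'I_K -> set T) :
  (forall i, measurable (A i)) -> measurable [set u | exists i, A i u].
Proof.
move=> mA; rewrite (_ : mkset _ = \bigcup_(i in [set: 'I_K]) A i).
  exact: fin_bigcup_measurable.
by apply/seteqP; split=> u /= [i]; exists i.
Qed.

End measurable_comparisons.

(** * Gaussian probabilities as real numbers *)

Section real_probability.
Context {R : realType} (s : R) (n : nat).
Implicit Types A B : set (n.-tuple R).

Definition gprob A : R := fine (gauss_prob s A).

Lemma gprobE A : measurable A -> gauss_prob s A = (gprob A)%:E.
Proof. by move=> mA; rewrite fineK// fin_num_measure. Qed.

Lemma gprob_le1 A : measurable A -> gprob A <= 1.
Proof. by move=> mA; rewrite -lee_fin -gprobE// probability_le1. Qed.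

Lemma le_gprob A B : measurable A -> measurable B -> A `<=` B ->
  gprob A <= gprob B.
Proof.
by move=> mA mB AB; rewrite -lee_fin -!gprobE// le_measure// inE.
Qed.

Lemma gprobU_le A B : measurable A -> measurable B ->
  gprob (A `|` B) <= gprob A + gprob B.
Proof.
move=> mA mB; rewrite -lee_fin EFinD -!gprobE//; last exact: measurableU.
exact: measureU2.
Qed.

Lemma gprobU A B : measurable A -> measurable B -> A `&` B = set0 ->
  gprob (A `|` B) = gprob A + gprob B.
Proof.
move=> mA mB AB; apply: EFin_inj; rewrite EFinD -!gprobE//; last exact: measurableU.
exact: measureU.
Qed.

Lemma gprobC A : measurable A -> gprob (~` A) = 1 - gprob A.
Proof.
move=> mA; apply: EFin_inj; rewrite EFinB -!gprobE//; last exact: measurableC.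
exact: probability_setC.
Qed.

Lemma gprob_exists_le K (A : 'I_K -> set (n.-tuple R)) :
  (forall i, measurable (A i)) ->
  gprob [set u | exists i, A i u] <= \sum_(i < K) gprob (A i).
Proof.
elim: K A => [|K IH] A mA.
  rewrite big_ord0 (_ : mkset _ = set0) ?/gprob ?measure0//.
  by apply/seteqP; split=> u // [[]].
rewrite big_ord_recl (_ : mkset _ =
    A ord0 `|` [set u | exists i, A (lift ord0 i) u]).
  have mE : measurable [set u | exists i, A (lift ord0 i) u].
    by apply: (measurable_exists_ord (A := fun i => A (lift ord0 i))).
  apply: (le_trans (gprobU_le (mA _) mE)); rewrite lerD2l.
  exact: (IH (fun i => A (lift ord0 i))).
apply/seteqP; split=> u /=.
  by move=> [i]; case: (unliftP ord0 i) => [j|] ->; [right; exists j|left].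
by move=> [|[i]]; [exists ord0|exists (lift ord0 i)].
Qed.

End real_probability.

(** * Tail, anti-concentration and shift bounds, uniform in the dimension *)

Section gaussian_bounds.
Context {R : realType} (s : R) (s0 : 0 < s).
Local Notation mu := (@lebesgue_measure R).
Local Notation C := ((Num.sqrt (pi *+ 2))^-1 : R).

Let C_gt0 : 0 < C.
Proof. by rewrite invr_gt0 sqrtr_gt0 mulrn_wgt0// pi_gt0. Qed.

Lemma measurable_dotp_itv n (a : 'I_n -> R) (x y : R) :
  measurable [set u | x < dotp a u <= y].
Proof.
rewrite (_ : mkset _ = [set u | x < dotp a u] `&` [set u | dotp a u <= y]).
  apply: measurableI; first by apply: measurable_lt_set => //; exact: measurable_dotp.
  by apply: measurable_le_set => //; exact: measurable_dotp.
by apply/seteqP; split=> u /= => [/andP[]|[-> ->]].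
Qed.

Lemma measurable_dotp_gt n (a : 'I_n -> R) (x : R) :
  measurable [set u | x < dotp a u].
Proof. by apply: measurable_lt_set => //; exact: measurable_dotp. Qed.

Lemma gprob_dotp_gt n (a : 'I_n -> R) (hi M : R) : sumsq a <= hi ->
  gprob s [set u | M < dotp a u] <= expR ((hi / 2 - M) / s ^+ 2).
Proof.
move=> ahi; rewrite -lee_fin -gprobE; last exact: measurable_dotp_gt.
apply: (le_trans (gauss_prob_dotp_gt s0 a M)); rewrite lee_fin ler_expR.
by rewrite ler_pM2r ?invr_gt0 ?exprn_gt0// lerD2r ler_pM2r ?invr_gt0.
Qed.

(** Anti-concentration: the density is at most its peak, which decreases in the variance. *)
Lemma gprob_dotp_itv_le n (a : 'I_n -> R) (lo x y : R) :
  0 < lo -> lo <= sumsq a -> x <= y ->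
  gprob s [set u | x < dotp a u <= y] <= C / (Num.sqrt lo * s) * (y - x).
Proof.
move=> lo0 loa xy; have a0 : 0 < sumsq a by exact: lt_le_trans loa.
rewrite -lee_fin -gprobE; last exact: measurable_dotp_itv.
rewrite gauss_prob_dotp_itv//; set t := Num.sqrt (sumsq a) * s.
have t0 : 0 < t by rewrite mulr_gt0 ?sqrtr_gt0.
apply: (@le_trans _ _ (\int[mu]_(z in `]x, y]) (C / (Num.sqrt lo * s))%:E)%E).
  apply: ge0_le_integral => //=.
  - by move=> z _; rewrite lee_fin normal_pdf_ge0.
  - by apply/measurable_EFinP; apply: measurable_funTS; exact: measurable_normal_pdf.
  move=> z _; rewrite lee_fin (le_trans (normal_pdf_ub _ _ _)) ?gt_eqF//.
  rewrite normal_peakE// ler_pM2l// lef_pV2 ?posrE ?mulr_gt0 ?sqrtr_gt0//.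
  by rewrite ler_pM2r// ler_sqrt// ltW.
rewrite integral_cst//= lebesgue_measure_itv/= lte_fin.
have [xy'|] := ltP x y; first by rewrite -EFinB -EFinM.
by rewrite mule0 lee_fin mulr_ge0 ?subr_ge0// divr_ge0 ?mulr_ge0 ?sqrtr_ge0 ?(ltW C_gt0)// ltW.
Qed.

(** On the interval [z^2] is at most [(|x| + |y|)^2], which bounds the density below uniformly over
    the variances between [lo s^2] and [hi s^2]. *)
Lemma gprob_dotp_itv_ge n (a : 'I_n -> R) (lo hi x y : R) :
  0 < lo -> lo <= sumsq a <= hi -> x < y ->
  C / (Num.sqrt hi * s) * expR (- (`|x| + `|y|) ^+ 2 / (lo * s ^+ 2 *+ 2)) * (y - x) <=
  gprob s [set u | x < dotp a u <= y].
Proof.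
move=> lo0 /andP[loa ahi] xy; have a0 : 0 < sumsq a by exact: lt_le_trans loa.
rewrite -lee_fin -gprobE; last exact: measurable_dotp_itv.
rewrite gauss_prob_dotp_itv//; set t := Num.sqrt (sumsq a) * s.
have t0 : 0 < t by rewrite mulr_gt0 ?sqrtr_gt0.
set L := (X in (X * _)%:E).
have -> : (L * (y - x))%:E = (\int[mu]_(z in `]x, y]) L%:E)%E.
  by rewrite integral_cst//= lebesgue_measure_itv/= lte_fin xy -EFinB -EFinM.
apply: ge0_le_integral => //=.
- by move=> z _; rewrite lee_fin /L !mulr_ge0 ?expR_ge0 ?invr_ge0 ?mulr_ge0 ?sqrtr_ge0// ltW.
- by apply/measurable_EFinP; apply: measurable_funTS; exact: measurable_normal_pdf.
move=> z; rewrite in_itv/= => /andP[xz zy].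
rewrite lee_fin normal_pdfE ?gt_eqF//= normal_peakE// /L.
have hi0 : 0 < hi by exact: lt_le_trans ahi.
apply: ler_pM.
- by rewrite mulr_ge0 ?invr_ge0 ?mulr_ge0 ?sqrtr_ge0// ltW.
- exact: expR_ge0.
- rewrite ler_pM2l// lef_pV2 ?posrE ?mulr_gt0 ?sqrtr_gt0//.
  by rewrite ler_pM2r// ler_sqrt// ltW.
rewrite /normal_fun ler_expR subr0 !mulNr lerN2.
have zxy : z ^+ 2 <= (`|x| + `|y|) ^+ 2.
  rewrite -(real_normK (num_real z)) lerXn2r ?nnegrE ?addr_ge0//.
  have := ler_norm y; have := ler_norm (- x); rewrite normrN => ? ?.
  have := normr_ge0 x; have := normr_ge0 y; move=> ? ?; rewrite ler_norml; apply/andP; split; lra.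
apply: ler_pM => //; [exact: sqr_ge0|by rewrite invr_ge0 mulrn_wge0// sqr_ge0|].
have t2 : 0 < t ^+ 2 *+ 2 by rewrite pmulrn_lgt0// exprn_gt0.
have ls : 0 < lo * s ^+ 2 *+ 2 by rewrite pmulrn_lgt0// mulr_gt0 ?exprn_gt0.
rewrite lef_pV2 ?posrE//; apply: ler_wMn2r.
by rewrite /t exprMn sqr_sqrtr ?(ltW a0)// ler_pM2r ?exprn_gt0.
Qed.

Lemma gprob_shift_contiguity n (m : 'I_n -> R) A c r : measurable A -> 0 < c ->
  sumsq m <= r ->
  gprob s (shift_tuple m @^-1` A) <= c * gprob s A + expR (r / s ^+ 2) / c.
Proof.
move=> mA c0 mr.
have mS : measurable (shift_tuple m @^-1` A).
  by rewrite -[X in measurable X]setTI; exact: measurable_shift_tuple.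
rewrite -lee_fin EFinD EFinM -!gprobE//.
apply: (le_trans (gauss_prob_shift_contiguity s0 m mA c0)).
rewrite leeD2l// lee_fin ler_pM2r ?invr_gt0// ler_expR ler_pM2r// invr_gt0.
by rewrite exprn_gt0.
Qed.

Lemma gprob_shift_tv n (m : 'I_n -> R) A c r : measurable A -> 0 < c ->
  sumsq m <= r ->
  gprob s (shift_tuple m @^-1` A) <=
  gprob s A + (c + (expR (r / s ^+ 2) - 1) / (4 * c)).
Proof.
move=> mA c0 mr.
have mS : measurable (shift_tuple m @^-1` A).
  by rewrite -[X in measurable X]setTI; exact: measurable_shift_tuple.
rewrite -lee_fin EFinD -!gprobE//.
apply: (le_trans (gauss_prob_shift_tv s0 m mA c0)).
rewrite leeD2l// lee_fin lerD2l ler_pM2r ?invr_gt0 ?mulr_gt0// lerD2r ler_expR.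
by rewrite ler_pM2r// invr_gt0 exprn_gt0.
Qed.

(** The choice of [M] makes the exponent at most [- k / d]; then [exp(- x) <= 1 / (1 + x)] and
    [k / (1 + k / d) <= d] conclude. *)
Lemma expR_tail_small (c k d : R) : 0 <= k -> 0 < d ->
  exists2 M, 0 < M & k * expR ((c - M) / s ^+ 2) <= d.
Proof.
move=> k0 d0; pose M := `|c| + 1 + s ^+ 2 * (k / d).
have s2 : 0 < s ^+ 2 by rewrite exprn_gt0.
have kd : 0 <= k / d by rewrite divr_ge0// ltW.
have skd : 0 <= s ^+ 2 * (k / d) by rewrite mulr_ge0// ltW.
have M0 : 0 < M by rewrite ltr_wpDr// ltr_wpDl.
exists M => //.
have h1 : (c - M) / s ^+ 2 <= - (k / d).
  rewrite ler_pdivrMr// mulNr [k / d * _]mulrC /M.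
  by have := ler_norm c; lra.
have h2 : expR (- (k / d)) <= (1 + k / d)^-1.
  rewrite expRN lef_pV2 ?posrE ?expR_gt0 ?ltr_pwDl//.
  exact: expR_ge1Dx.
apply: (@le_trans _ _ (k * (1 + k / d)^-1)).
  by rewrite ler_wpM2l// (le_trans _ h2)// ler_expR.
rewrite ler_pdivrMr ?ltr_pwDl// mulrDr mulr1 mulrCA divff ?gt_eqF// mulr1.
by rewrite lerDr ltW.
Qed.

End gaussian_bounds.

(** * The gap between neighbouring distribution functions *)

Section model_averaging_weight.
Context {R : realType} (s alpha : R) (s0 : 0 < s) (alpha0 : 0 < alpha).

(** This is [lambda_hat] as a function of [z], the last coordinate of sqrt n [betaU]; [q z^2] stands
    for the squared distance between the two fitted vectors. *)
Definition weight (q z : R) : R :=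
  (1 + expR (- (2 * alpha * k2%:R)) * expR (alpha * (q * z ^+ 2) / s ^+ 2))^-1.

Let den_gt0 q z :
  0 < 1 + expR (- (2 * alpha * k2%:R)) * expR (alpha * (q * z ^+ 2) / s ^+ 2).
Proof. by rewrite ltr_wpDr// mulr_ge0 ?expR_ge0. Qed.

Lemma weight_gt0 q z : 0 < weight q z.
Proof. by rewrite invr_gt0. Qed.

Lemma weight_lt1 q z : weight q z < 1.
Proof. by rewrite invf_lt1// ltrDl mulr_gt0 ?expR_gt0. Qed.

Lemma weight_ge q K z x : 0 <= q <= K -> `|z| <= x -> weight K x <= weight q z.
Proof.
move=> /andP[q0 qK] zx; rewrite lef_pV2 ?posrE// lerD2l ler_pM2l ?expR_gt0//.
rewrite ler_expR ler_pM2r ?invr_gt0 ?exprn_gt0// ler_pM2l//.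
apply: ler_pM => //; first exact: sqr_ge0.
rewrite -(real_normK (num_real z)) lerXn2r ?nnegrE//.
exact: le_trans zx.
Qed.

Lemma measurable_weight q : measurable_fun [set: R] (weight q).
Proof.
apply: continuous_measurable_fun => z.
apply: cvgV; first by rewrite gt_eqF.
apply: cvgD; first exact: cvg_cst.
apply: cvgM; first exact: cvg_cst.
apply: (cvg_comp _ expR); last exact: continuous_expR.
apply: cvgM; last exact: cvg_cst.
apply: cvgM; first exact: cvg_cst.
apply: cvgM; first exact: cvg_cst.
exact: exprn_continuous.
Qed.

End model_averaging_weight.

(** * Separation of the averaged events at two local parameters *)

Section gap.
Context {R : realType} (s alpha : R) (s0 : 0 < s) (alpha0 : 0 < alpha).
Context (K : nat) (l : 'I_K) (t : 'I_K -> R).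
Local Notation weight := (weight s alpha).

(* Here [dotp (a i) u] is the i-th coordinate of sqrt n (betaU - theta), [g] is
   sqrt n times the last coordinate of theta, and [e] is the direction in which
   betaR - betaU points. *)
Definition avg_event n (a : 'I_K -> 'I_n -> R) (e : 'I_K -> R) (q g : R) :
    set (n.-tuple R) :=
  [set u | forall i, let z := dotp (a l) u + g in
    dotp (a i) u + weight q z * (e i * z) <= t i].

Lemma measurable_avg_event n (a : 'I_K -> 'I_n -> R) e q g :
  measurable (avg_event a e q g).
Proof.
apply: (measurable_forall_ord (A := fun i => [set u | _])) => i.
have mz : measurable_fun setT (fun u => dotp (a l) u + g).
  by apply: measurable_funD => //; exact: measurable_dotp.
apply: measurable_le_set => //; apply: measurable_funD; first exact: measurable_dotp.
apply: measurable_funM; last exact: measurable_funM.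
apply: (measurableT_comp _ mz); exact: measurable_weight.
Qed.

(** The margin 1 leaves room for the correction terms, which are later kept below some [h <= 1]. *)
Let others_low n (a : 'I_K -> 'I_n -> R) : set (n.-tuple R) :=
  [set u | forall i, i != l -> dotp (a i) u <= t i - 1].

Let measurable_others_low n (a : 'I_K -> 'I_n -> R) : measurable (others_low a).
Proof.
apply: (measurable_forall_ord (A := fun i => [set u | _])) => i.
have [->|il] := eqVneq i l.
  by rewrite (_ : mkset _ = setT)//; apply/seteqP.
rewrite (_ : mkset _ = [set u | dotp (a i) u <= t i - 1]).
  by apply: measurable_le_set => //; exact: measurable_dotp.
by apply/seteqP; split=> u /= h; [exact: h|move=> _].
Qed.

(* The mean shift [m] turns a lower bound on the joint event into a union bound
   over the tails of one-dimensional marginals. *)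
Lemma gprob_joint_ge (lo hi x y : R) : 0 < lo -> lo <= hi -> x < y ->
  exists b : 'I_K -> R, forall r, exists2 c, 0 < c &
    forall n (a : 'I_K -> 'I_n -> R) (m : 'I_n -> R),
      (forall i, lo <= sumsq (a i) <= hi) -> sumsq m <= r ->
      (forall i, i != l -> \sum_j a i j * m j = b i) ->
      \sum_j a l j * m j = 0 ->
      c <= gprob s ([set u | x < dotp (a l) u <= y] `&` others_low a).
Proof.
move=> lo0 lohi xy.
pose p0 := (Num.sqrt (pi *+ 2))^-1 / (Num.sqrt hi * s) *
  expR (- (`|x| + `|y|) ^+ 2 / (lo * s ^+ 2 *+ 2)) * (y - x).
have hi0 : 0 < hi by exact: lt_le_trans lohi.
have p00 : 0 < p0.
  rewrite /p0 !mulr_gt0 ?expR_gt0 ?subr_gt0// ?invr_gt0 ?mulr_gt0 ?sqrtr_gt0//.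
  by rewrite mulrn_wgt0// pi_gt0.
have p02 : 0 < p0 / 2 by rewrite divr_gt0.
have [M M0 MK] := expR_tail_small s0 (hi / 2) (ler0n R K) p02.
(* This target puts the other coordinates at distance [M] below [t i - 1], so that they fail only if
   a centred marginal exceeds [M]; the union of these events has probability at most [p0 / 2]. It is
   fixed before [r] because the length of a shift that realizes it depends on it. *)
exists (fun i => t i - 1 - M) => r.
pose w := expR (r / s ^+ 2); have w0 : 0 < w by exact: expR_gt0.
(* Comes from contiguity with constant [4 w / p0], which gives
   [p0 / 2 <= (4 w / p0) P(A) + p0 / 4]. *)
exists (p0 ^+ 2 / (16 * w)).
  by apply: divr_gt0; [exact: exprn_gt0|apply: mulr_gt0].
move=> n a m ha mr mb ml.
set A := (X in gprob s X).
have mA : measurable A by apply: measurableI => //; exact: measurable_dotp_itv.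
pose T := [set u | exists i, M < dotp (a i) u].
have mT : measurable T.
  by apply: (measurable_exists_ord (A := fun i => [set u | _])) => i; exact: measurable_dotp_gt.
have dotp_shift i u : dotp (a i) (shift_tuple m u) = \sum_j a i j * m j + dotp (a i) u.
  rewrite /dotp -big_split; apply: eq_bigr => j _.
  by rewrite tnth_mktuple mulrDr.
pose W := [set u | x < dotp (a l) u <= y].
have mW : measurable W by exact: measurable_dotp_itv.
have mS : measurable (shift_tuple m @^-1` A).
  by rewrite -[X in measurable X]setTI; exact: measurable_shift_tuple.
have sub : W `<=` shift_tuple m @^-1` A `|` T.
  move=> u Wu; have [Tu|Tu] := pselect (T u); [by right|left].
  split; first by rewrite /= dotp_shift ml add0r.
  move=> i il; rewrite dotp_shift mb//.
  have : dotp (a i) u <= M by rewrite leNgt; apply/negP => h; apply: Tu; exists i.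
  by lra.
have PT : gprob s T <= p0 / 2.
  apply: le_trans MK; apply: (le_trans (gprob_exists_le s _)).
    by move=> i; exact: measurable_dotp_gt.
  rewrite mulr_natl -[X in _ *+ X](card_ord K) -sumr_const; apply: ler_sum => i _.
  by apply: gprob_dotp_gt => //; case/andP: (ha i).
have PW : p0 <= gprob s W by exact: gprob_dotp_itv_ge.
have PS : p0 / 2 <= gprob s (shift_tuple m @^-1` A).
  have := le_gprob s mW (measurableU _ _ mS mT) sub.
  by have := gprobU_le s mS mT; lra.
have c0 : 0 < 4 * w / p0 by apply: divr_gt0 => //; apply: mulr_gt0.
have := gprob_shift_contiguity s0 mA c0 mr; rewrite -/w => cont.
have E : w / (4 * w / p0) = p0 / 4 by field; rewrite !gt_eqF.
rewrite E in cont.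
have h : p0 / 4 <= 4 * w / p0 * gprob s A by lra.
have -> : p0 ^+ 2 / (16 * w) = (4 * w / p0)^-1 * (p0 / 4).
  by field; rewrite !gt_eqF.
by rewrite ler_pdivrMl.
Qed.

(** The event at [g] and the joint event of the last hypothesis are disjoint, and off two
    exceptional sets both lie in the event at [g']. These sets are [T], where the [l]-th coordinate
    is large, and [N], where some coordinate is within [h] of its threshold; each has probability at
    most [c1 / 4]. *)
Lemma gap_of_interval (lo hi x y G c1 : R) :
  0 < lo -> lo <= hi -> x < y -> 0 <= G -> 0 < c1 ->
  exists2 kap, 0 < kap &
    forall n (a : 'I_K -> 'I_n -> R) (e : 'I_K -> R) (q g g' : R),
      (forall i, lo <= sumsq (a i) <= hi) ->
      (forall i, i != l -> `|e i| <= kap) -> `|g| <= G -> `|g'| <= G ->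
      (forall w, w <= y -> w + weight q (w + g') * (e l * (w + g')) <= t l) ->
      (forall w, w + weight q (w + g) * (e l * (w + g)) <= t l -> w <= x) ->
      c1 <= gprob s ([set u | x < dotp (a l) u <= y] `&` others_low a) ->
      c1 / 2 <= gprob s (avg_event a e q g') - gprob s (avg_event a e q g).
Proof.
move=> lo0 lohi xy G0 c10.
have c14 : 0 < c1 / 4 by rewrite divr_gt0.
have [M M0 MK] := expR_tail_small s0 (hi / 2) (ler0n R 2) c14.
pose D := (Num.sqrt (pi *+ 2))^-1 / (Num.sqrt lo * s).
have D0 : 0 < D.
  rewrite /D divr_gt0 ?invr_gt0 ?mulr_gt0 ?sqrtr_gt0//.
  by rewrite mulrn_wgt0// pi_gt0.
(* Small enough for [K] intervals of length [2 h], each of probability at most [2 h D], to have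
   total probability at most [c1 / 4]; the bound 1 matches the margin in [others_low]. *)
pose h := Num.min 1 (c1 / (8 * (K%:R + 1) * D)).
have K1 : 0 < K%:R + 1 :> R by rewrite ltr_wpDl.
have q0 : 0 < 8 * (K%:R + 1) * D by do 2 apply: mulr_gt0 => //.
have h0 : 0 < h.
  by rewrite lt_min ltr01/=; apply: divr_gt0.
have h1 : h <= 1 by rewrite ge_min lexx.
have hc : K%:R * (D * (2 * h)) <= c1 / 4.
  apply: (@le_trans _ _ ((K%:R + 1) * (D * (2 * h)))).
    apply: ler_wpM2r; last by rewrite lerDl.
    by apply: mulr_ge0; [exact: ltW|apply: mulr_ge0 => //; exact: ltW].
  have : h <= c1 / (8 * (K%:R + 1) * D) by rewrite ge_min lexx orbT.
  by rewrite ler_pdivlMr// => hh; lra.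
have MG : 0 < M + G by rewrite ltr_wpDr.
(* Off [T] one has [|z| <= M + G], and the weight is below 1, so each correction is at most [h]. *)
exists (h / (M + G)); first by rewrite divr_gt0.
move=> n a e q g g' ha he gG g'G hi_l lo_l hB.
set B := (X in gprob s X) in hB.
have mB : measurable B by apply: measurableI => //; exact: measurable_dotp_itv.
pose N := [set u | exists i, t i - h < dotp (a i) u <= t i + h].
pose na (v : 'I_n -> R) (j : 'I_n) : R := - v j.
pose T := [set u | M < dotp (a l) u] `|` [set u | M < dotp (na (a l)) u].
have dotpN v u : dotp (na v) u = - dotp v u.
  by rewrite /dotp -sumrN; apply: eq_bigr => j _; rewrite mulNr.
have sumsqN v : sumsq (na v) = sumsq v.
  by apply: eq_bigr => j _; rewrite sqrrN.
have mT : measurable T by apply: measurableU; exact: measurable_dotp_gt.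
have mN : measurable N.
  by apply: (measurable_exists_ord (A := fun i => [set u | _])) => i; exact: measurable_dotp_itv.
have mE := measurable_avg_event a e q g.
have mE' := measurable_avg_event a e q g'.
have hal := ha l; case/andP: hal => _ hal.
have PT : gprob s T <= c1 / 4.
  apply: le_trans MK; apply: (le_trans (gprobU_le _ _ _)); try exact: measurable_dotp_gt.
  rewrite mulr_natl mulr2n; apply: lerD; apply: gprob_dotp_gt => //.
  by rewrite sumsqN.
have PN : gprob s N <= c1 / 4.
  apply: le_trans hc; apply: (le_trans (gprob_exists_le s _)).
    by move=> i; exact: measurable_dotp_itv.
  rewrite mulr_natl -[X in _ *+ X](card_ord K) -sumr_const; apply: ler_sum => i _.
  have /andP[hai _] := ha i.
  have th : t i - h <= t i + h by lra.
  apply: (le_trans (gprob_dotp_itv_le s0 lo0 hai th)); rewrite -/D.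
  by rewrite ler_pM2l//; lra.
have corr u i gg : ~ T u -> i != l -> `|gg| <= G ->
    `|weight q (dotp (a l) u + gg) * (e i * (dotp (a l) u + gg))| <= h.
  move=> Tu il ggG; set z := dotp (a l) u + gg.
  have zMG : `|z| <= M + G.
    apply: (le_trans (ler_normD _ _)); apply: lerD => //.
    rewrite ler_norml; apply/andP; split; rewrite leNgt; apply/negP => hh; apply: Tu.
      by right; rewrite /= dotpN; lra.
    by left.
  rewrite !normrM (gtr0_norm (weight_gt0 _ _ _ _)).
  apply: (@le_trans _ _ (1 * (h / (M + G) * (M + G)))); last first.
    by rewrite mul1r divfK ?gt_eqF.
  apply: ler_pM; [exact/ltW/weight_gt0|by rewrite mulr_ge0|exact/ltW/weight_lt1|].
  by apply: ler_pM => //; exact: he.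
have sub : avg_event a e q g `|` B `<=` avg_event a e q g' `|` (N `|` T).
  move=> u; have [Tu|Tu] := pselect (T u); first by right; right.
  have [Nu|Nu] := pselect (N u); first by right; left.
  (* One [h] absorbs the correction at [g], the other the correction at [g']. *)
  have nN i : dotp (a i) u <= t i + h -> dotp (a i) u <= t i - h.
    move=> h2; rewrite leNgt; apply/negP => h3; apply: Nu; exists i.
    by rewrite h2 h3.
  move=> [Eu|[Wu Lu]]; left => i /=.
  - have [->|il] := eqVneq i l.
      by apply: hi_l; apply: le_trans (ltW xy); apply: lo_l; exact: Eu.
    have := corr u i g Tu il gG; have := corr u i g' Tu il g'G.
    have := Eu i => /=; move: (weight q _ * _) (weight q _ * _) => v v' h2.
    rewrite !ler_norml => /andP[_ h3] /andP[h4 _].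
    by have := nN i; lra.
  - have [->|il] := eqVneq i l; first by apply: hi_l; case/andP: Wu.
    have := corr u i g' Tu il g'G; move: (weight q _ * _) => v.
    rewrite ler_norml => /andP[_ h3].
    by have := Lu i il; lra.
have dis : avg_event a e q g `&` B = set0.
  rewrite -subset0 => u [Eu [/andP[xW _] _]].
  by have := lo_l _ (Eu l); rewrite leNgt xW.
have := le_gprob s (measurableU _ _ mE mB) (measurableU _ _ mE' (measurableU _ _ mN mT)) sub.
rewrite gprobU//.
have := gprobU_le s mE' (measurableU _ _ mN mT).
have := gprobU_le s mN mT.
by move=> *; lra.
Qed.

(** For [eps > 0] the interval is []t_l, t_l + eps L]]: up to its right end [z = w + eps - t_l] is
    at most [eps (1 + L)], and since [(1 - L) (1 + L) < 1] the constraint [(1 - weight) z <= eps]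
    still holds. For [eps < 0] the interval is []t_l + eps L, t_l]] and the two local parameters
    exchange roles. *)
Lemma avg_event_gap (lo hi kq eps : R) : 0 < lo -> lo <= hi -> eps != 0 ->
  exists b : 'I_K -> R, forall r, exists c kap, [/\ 0 < c, 0 < kap &
    forall n (a : 'I_K -> 'I_n -> R) (e : 'I_K -> R) (q : R) (m : 'I_n -> R),
      (forall i, lo <= sumsq (a i) <= hi) -> sumsq m <= r ->
      (forall i, i != l -> \sum_j a i j * m j = b i) ->
      \sum_j a l j * m j = 0 ->
      e l = -1 -> (forall i, i != l -> `|e i| <= kap) -> 0 <= q <= kq ->
      c <= `|gprob s (avg_event a e q (eps - t l)) -
             gprob s (avg_event a e q (- t l))| ].
Proof.
move=> lo0 lohi eps0.
(* A lower bound for the weight when [0 <= q <= kq] and [|z| <= 2 |eps|]; this range suffices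
   because [|eps| (1 + L) <= 2 |eps|]. *)
pose L := weight kq (2 * `|eps|).
have L0 : 0 < L by exact: weight_gt0.
have L1 : L < 1 by exact: weight_lt1.
pose G := `|t l| + `|eps|.
have G0 : 0 <= G by rewrite addr_ge0.
have gG : `|- t l| <= G by rewrite normrN lerDl.
have g'G : `|eps - t l| <= G.
  by rewrite (le_trans (ler_normB _ _))// addrC.
have shiftE q w : w + weight q (w + - t l) * (-1 * (w + - t l)) =
    (1 - weight q (w - t l)) * (w - t l) + t l by ring.
have shiftE' q w : w + weight q (w + (eps - t l)) * (-1 * (w + (eps - t l))) =
    (1 - weight q (w + (eps - t l))) * (w + (eps - t l)) - eps + t l by ring.
have [epos|eneg] : 0 < eps \/ eps < 0.
  by case: (ltgtP eps 0) eps0 => // ? _; [right|left].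
- have eL : t l < t l + eps * L by rewrite ltrDl mulr_gt0.
  have [b hb] := gprob_joint_ge lo0 lohi eL.
  exists b => r; have [c c0 hc] := hb r.
  have [kap kap0 hk] := gap_of_interval lo0 lohi eL G0 c0.
  exists (c / 2), kap; split=> [|//|n a e q m ha mr mb ml el he hq]; first by rewrite divr_gt0.
  apply: le_trans (ler_norm _); apply: hk => //; last exact: (hc n a m).
  + move=> w wt; rewrite el shiftE'; set z := w + _.
    have w1 := weight_lt1 s alpha q z; have w0 := weight_gt0 s alpha q z.
    have zle : z <= eps + eps * L by rewrite /z; lra.
    have [z0|z0] := leP z 0; first by nra.
    have LW : L <= weight q z.
      apply: weight_ge => //; rewrite !gtr0_norm//.
      by apply: (le_trans zle); nra.
    have : (1 - weight q z) * z <= (1 - L) * (eps + eps * L) by nra.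
    by nra.
  + move=> w; rewrite el shiftE => hw; rewrite leNgt; apply/negP => tw.
    have w1 := weight_lt1 s alpha q (w - t l).
    have : 0 < (1 - weight q (w - t l)) * (w - t l) by rewrite mulr_gt0 ?subr_gt0.
    by lra.
- have eL : t l + eps * L < t l by rewrite gtrDl nmulr_rlt0.
  have [b hb] := gprob_joint_ge lo0 lohi eL.
  exists b => r; have [c c0 hc] := hb r.
  have [kap kap0 hk] := gap_of_interval lo0 lohi eL G0 c0.
  exists (c / 2), kap; split=> [|//|n a e q m ha mr mb ml el he hq]; first by rewrite divr_gt0.
  rewrite distrC; apply: le_trans (ler_norm _); apply: hk => //; last exact: (hc n a m).
  + move=> w wt; rewrite el shiftE.
    have w1 := weight_lt1 s alpha q (w - t l).
    have : (1 - weight q (w - t l)) * (w - t l) <= 0.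
      by rewrite mulr_ge0_le0// ?subr_ge0 ?subr_le0// ltW.
    by lra.
  + move=> w; rewrite el shiftE'; set z := w + _ => hw.
    have w1 := weight_lt1 s alpha q z; have w0 := weight_gt0 s alpha q z.
    rewrite leNgt; apply/negP => tw.
    have zge : eps + eps * L < z by rewrite /z; lra.
    have [z0|z0] := leP 0 z.
      have : 0 <= (1 - weight q z) * z by rewrite mulr_ge0// subr_ge0 ltW.
      by lra.
    have LW : L <= weight q z.
      apply: weight_ge => //; rewrite !ltr0_norm//.
      by nra.
    have : (1 - L) * (eps + eps * L) <= (1 - weight q z) * z by nra.
    by nra.
Qed.

End gap.

(** * Least squares and the limit of X'X/n *)

Section matrix_limits.
Context {R : realType}.

Lemma cvgn_sum (I : Type) (r : seq I) (F : I -> nat -> R) (a : I -> R) :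
  (forall i, F i @ \oo --> a i) ->
  (fun n => \sum_(i <- r) F i n) @ \oo --> \sum_(i <- r) a i.
Proof.
move=> Fa; elim: r => [|i r IH].
  rewrite big_nil (_ : (fun n => _) = fun=> 0); first exact: cvg_cst.
  by apply/funext => n; rewrite big_nil.
rewrite big_cons (_ : (fun n => _) = fun n => F i n + \sum_(j <- r) F j n).
  exact: cvgD.
by apply/funext => n; rewrite big_cons.
Qed.

Lemma cvgn_prod (I : Type) (r : seq I) (F : I -> nat -> R) (a : I -> R) :
  (forall i, F i @ \oo --> a i) ->
  (fun n => \prod_(i <- r) F i n) @ \oo --> \prod_(i <- r) a i.
Proof.
move=> Fa; elim: r => [|i r IH].
  rewrite big_nil (_ : (fun n => _) = fun=> 1); first exact: cvg_cst.
  by apply/funext => n; rewrite big_nil.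
rewrite big_cons (_ : (fun n => _) = fun n => F i n * \prod_(j <- r) F j n).
  exact: cvgM.
by apply/funext => n; rewrite big_cons.
Qed.

(** Entrywise convergence reduces products, determinants and adjugates to limits of real sums and
    products. *)
Definition mxcvg p q (A : nat -> 'M[R]_(p, q)) (B : 'M[R]_(p, q)) :=
  forall i j, (fun n => A n i j) @ \oo --> B i j.

Lemma cvg_mxcvg p q (A : nat -> 'M[R]_(p, q)) B : A @ \oo --> B -> mxcvg A B.
Proof.
move=> AB i j.
exact: (cvg_comp _ _ AB (@coord_continuous R p q i j B)).
Qed.

Lemma mxcvg_cst p q (A : 'M[R]_(p, q)) : mxcvg (fun=> A) A.
Proof. by move=> i j; exact: cvg_cst. Qed.

Lemma mxcvg_mul p q r (A : nat -> 'M[R]_(p, q)) A' (B : nat -> 'M[R]_(q, r)) B' :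
  mxcvg A A' -> mxcvg B B' -> mxcvg (fun n => A n *m B n) (A' *m B').
Proof.
move=> cA cB i j; rewrite mxE (_ : (fun n => _) = fun n => \sum_k A n i k * B n k j).
  by apply: cvgn_sum => k; apply: cvgM; [exact: cA|exact: cB].
by apply/funext => n; rewrite mxE.
Qed.

Lemma mxcvg_det p (A : nat -> 'M[R]_p) A' :
  mxcvg A A' -> (fun n => \det (A n)) @ \oo --> \det A'.
Proof.
move=> cA; apply: cvgn_sum => /= s; apply: cvgM; first exact: cvg_cst.
by apply: cvgn_prod => i; exact: cA.
Qed.

Lemma mxcvg_adj p (A : nat -> 'M[R]_p) A' :
  mxcvg A A' -> mxcvg (fun n => \adj (A n)) (\adj A').
Proof.
move=> cA i j; rewrite mxE (_ : (fun n => _) = fun n => cofactor (A n) j i); last first.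
  by apply/funext => n; rewrite mxE.
apply: cvgM; first exact: cvg_cst.
apply: mxcvg_det => k h; rewrite !mxE.
rewrite (_ : (fun n => _) = fun n => A n (lift j k) (lift i h)); first exact: cA.
by apply/funext => n; rewrite !mxE.
Qed.

Lemma mxcvg_unitmx p (A : nat -> 'M[R]_p) A' :
  mxcvg A A' -> A' \in unitmx -> \forall n \near \oo, A n \in unitmx.
Proof.
move=> cA; rewrite unitmxE unitfE => A'0.
have := mxcvg_det cA => /cvgr_neq0 => /(_ A'0) h.
by near=> n; rewrite unitmxE unitfE; near: n.
Unshelve. all: by end_near. Qed.

Lemma mxcvg_inv p (A : nat -> 'M[R]_p) A' :
  mxcvg A A' -> A' \in unitmx -> mxcvg (fun n => invmx (A n)) (invmx A').
Proof.
move=> cA uA' i j.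
have detA' : \det A' != 0 by rewrite -unitfE -unitmxE.
rewrite /invmx uA' mxE.
have : (fun n => (\det (A n))^-1 * (\adj (A n)) i j) @ \oo --> (\det A')^-1 * (\adj A') i j.
  by apply: cvgM; [apply: cvgV => //; exact: mxcvg_det|exact: mxcvg_adj].
(* [invmx] is given by the adjugate formula only on invertible matrices, so the two sequences agree
   eventually. *)
apply: cvg_trans; apply: near_eq_cvg.
have uA := mxcvg_unitmx cA uA'.
near=> n; have -> : A n \in unitmx by near: n.
by rewrite [RHS]mxE.
Unshelve. all: by end_near. Qed.

Lemma trmx_scale p q (a : R) (A : 'M[R]_(p, q)) : (a *: A)^T = a *: A^T.
Proof. by apply/matrixP => i j; rewrite !mxE. Qed.

(** A nonzero row [v] of the kernel matrix would give [v Q v^T = 0]. *)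
Lemma posdef_unitmx p (Q : 'M[R]_p) : posdef Q -> Q \in unitmx.
Proof.
move=> [Qsym Qpos]; rewrite -row_free_unit -kermx_eq0; apply/eqP/row_matrixP => i.
rewrite row0; apply/eqP; apply/negPn/negP => ri0.
have := Qpos (row i (kermx Q))^T; rewrite trmx_eq0 => /(_ ri0).
by rewrite trmxK -row_mul mulmx_ker row0 mul0mx mxE ltxx.
Qed.

(** The entry is the value of the quadratic form of [Q] at the [i]-th column of its inverse. *)
Lemma posdef_inv_diag_gt0 p (Q : 'M[R]_p) i : posdef Q -> 0 < invmx Q i i.
Proof.
move=> Qpd; have uQ := posdef_unitmx Qpd; have [Qsym Qpos] := Qpd.
pose d : 'cV[R]_p := delta_mx i 0.
have d0 : d != 0.
  by apply/eqP => /matrixP/(_ i 0); rewrite !mxE !eqxx/= => /eqP; rewrite oner_eq0.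
have v0 : invmx Q *m d != 0.
  apply: contra_neq d0 => h.
  by rewrite -[d]mul1mx -(mulmxV uQ) -mulmxA h mulmx0.
have := Qpos _ v0; rewrite trmx_mul trmx_inv Qsym mulmxKV// mulmxA.
by rewrite /d trmx_delta -rowE -colE !mxE.
Qed.

Lemma posdef_ulsubmx p q (Q : 'M[R]_(p + q)) : posdef Q -> posdef (ulsubmx Q).
Proof.
move=> [Qsym Qpos]; split; first by apply/matrixP => i j; rewrite !mxE -{1}Qsym mxE.
move=> v v0; have := Qpos (col_mx v 0).
rewrite -{1}[Q]submxK tr_col_mx trmx0 mul_row_block mul_row_col !mul0mx !mulmx0 !addr0.
apply; apply: contra_neq v0 => /(congr1 usubmx).
by rewrite col_mxKu => ->; apply/matrixP => i j; rewrite !mxE.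
Qed.

End matrix_limits.

(** * Exact finite-sample algebra of the estimators *)

Section least_squares.
Context {R : realType} (k1 n : nat) (n0 : (0 < n)%N).
Context (X : 'M[R]_(n, k1 + 1)) (s alpha : R).
Let S := n%:R^-1 *: (X^T *m X).
Hypothesis uS : S \in unitmx.
Hypothesis uA : ulsubmx S \in unitmx.
Let l : 'I_(k1 + 1) := rshift k1 ord0.
Let sn : R := Num.sqrt n%:R.

Let n_gt0 : 0 < n%:R :> R. Proof. by rewrite ltr0n. Qed.
Let sn0 : sn != 0. Proof. by rewrite gt_eqF// sqrtr_gt0. Qed.
Let sn2 : sn ^+ 2 = n%:R. Proof. by rewrite sqr_sqrtr// ltW. Qed.

Let XXE : X^T *m X = n%:R *: S.
Proof. by rewrite /S scalerA divff ?scale1r// gt_eqF. Qed.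

Let uXX : X^T *m X \in unitmx.
Proof. by rewrite XXE unitmxZ// unitfE gt_eqF. Qed.

(** The matrix [G] that maps the error vector to sqrt n ([betaU] - [theta]). *)
Definition ls_mx : 'M[R]_(k1 + 1, n) := sn *: (invmx (X^T *m X) *m X^T).

Definition ls_rows (i : 'I_(k1 + 1)) (j : 'I_n) : R := ls_mx i j.

(** The direction [e = (D, -1)]; the factors [n] cancel in [D], which is why the blocks of [S] can
    be used. *)
Definition ls_dir : 'cV[R]_(k1 + 1) :=
  col_mx (invmx (ulsubmx S) *m ursubmx S) (- 1%:M).

Lemma ls_mxX : ls_mx *m X = sn%:M.
Proof. by rewrite -scalemxAl -mulmxA mulVmx// scalemx1. Qed.

Lemma sumsq_ls_rows i : sumsq (ls_rows i) = invmx S i i.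
Proof.
have E : ls_mx *m ls_mx^T = invmx S.
  rewrite /ls_mx trmx_scale trmx_mul trmxK -scalemxAl -scalemxAr scalerA -expr2 sn2.
  rewrite mulmxA -(mulmxA _ X^T) mulVmx// mul1mx trmx_inv trmx_mul trmxK XXE.
  by rewrite invmxZ ?scalerA ?divff ?scale1r ?gt_eqF// -XXE.
rewrite -E mxE /sumsq; apply: eq_bigr => j _.
by rewrite [X in _ = _ * X]mxE expr2.
Qed.

Lemma dotp_ls_rows i u : dotp (ls_rows i) u = (ls_mx *m colv u) i 0.
Proof. by rewrite mxE; apply: eq_bigr => j _; rewrite [X in _ = _ * X]mxE. Qed.

(** Since [G X] is sqrt n times the identity, shifting the error mean by [X b / sqrt n] moves the
    scaled estimator by exactly [b]. This realizes the shift required by [gprob_joint_ge]. *)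
Lemma dotp_ls_shift (b : 'cV[R]_(k1 + 1)) i :
  \sum_j ls_rows i j * (sn^-1 *: (X *m b)) j 0 = b i 0.
Proof.
transitivity ((ls_mx *m (sn^-1 *: (X *m b))) i 0); first by rewrite mxE.
by rewrite -scalemxAr mulmxA ls_mxX mul_scalar_mx scalerA mulVf// scale1r.
Qed.

Lemma sumsq_shift (b : 'cV[R]_(k1 + 1)) :
  sumsq (fun j => (sn^-1 *: (X *m b)) j 0) = (b^T *m S *m b) 0 0.
Proof.
transitivity (((sn^-1 *: (X *m b))^T *m (sn^-1 *: (X *m b))) 0 0).
  by rewrite mxE; apply: eq_bigr => j _; rewrite [X in _ = X * _]mxE expr2.
rewrite trmx_scale -scalemxAl -scalemxAr scalerA -expr2 exprVn sn2 trmx_mul.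
by rewrite /S -scalemxAr -scalemxAl !mulmxA.
Qed.

Let XtX_sub : (lsubmx X)^T *m lsubmx X = n%:R *: ulsubmx S.
Proof.
apply/matrixP => i j; rewrite !mxE mulrA divff ?mul1r ?gt_eqF//.
by apply: eq_bigr => k _; rewrite !mxE.
Qed.

Let XtX2_sub : (lsubmx X)^T *m rsubmx X = n%:R *: ursubmx S.
Proof.
apply/matrixP => i j; rewrite !mxE mulrA divff ?mul1r ?gt_eqF//.
by apply: eq_bigr => k _; rewrite !mxE.
Qed.

(** The omitted-variable formula: dropping the last regressor transfers its coefficient to the
    others through [D]. *)
Lemma betaR_betaU (Y : 'cV[R]_n) :
  betaR X Y = betaU X Y + betaU X Y l 0 *: ls_dir.
Proof.
set b := betaU X Y.
have normal_eq : X^T *m Y = X^T *m X *m b.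
  by rewrite /b /betaU !mulmxA mulmxV// mul1mx.
(* the rows of the normal equations of the full model that belong to X1 *)
have normal_eq1 : (lsubmx X)^T *m Y =
    (lsubmx X)^T *m lsubmx X *m usubmx b + (lsubmx X)^T *m rsubmx X *m dsubmx b.
  have -> : (lsubmx X)^T = usubmx X^T by rewrite -trmx_lsub.
  transitivity (usubmx X^T *m (X *m b)).
    by rewrite mul_usub_mx normal_eq -mulmxA -mul_usub_mx.
  rewrite -!mulmxA -mulmxDr; congr (_ *m _).
  by rewrite -mul_row_col hsubmxK vsubmxK.
have uX1 : (lsubmx X)^T *m lsubmx X \in unitmx.
  by rewrite XtX_sub unitmxZ// unitfE gt_eqF.
rewrite /betaR -mulmxA normal_eq1 mulmxDr mulKmx// -{3}[b]vsubmxK /ls_dir.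
have bl : dsubmx b = (b l 0)%:M.
  by apply/matrixP => i j; rewrite !ord1 [RHS]mxE eqxx mulr1n [LHS]mxE.
rewrite scale_col_mx add_col_mx; congr col_mx.
  congr (_ + _); rewrite bl mul_mx_scalar -scalemxAr; congr (_ *: _).
  rewrite XtX_sub XtX2_sub invmxZ; last by rewrite -XtX_sub.
  by rewrite -scalemxAl -scalemxAr scalerA mulVf ?scale1r// gt_eqF.
by rewrite bl scalerN scalemx1 subrr.
Qed.

Lemma sqnormE p (v : 'cV[R]_p) : sqnorm v = (v^T *m v) 0 0.
Proof. by rewrite mxE; apply: eq_bigr => i _; rewrite mxE expr2. Qed.

Lemma sqnorm_betaR_betaU (Y : 'cV[R]_n) :
  sqnorm (X *m betaR X Y - X *m betaU X Y) =
  (ls_dir^T *m S *m ls_dir) 0 0 * (sn * betaU X Y l 0) ^+ 2.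
Proof.
rewrite -mulmxBr betaR_betaU addrC addKr -scalemxAr; set b := betaU X Y l 0.
rewrite sqnormE trmx_scale.
rewrite -scalemxAl -scalemxAr scalerA [LHS]mxE exprMn sn2 trmx_mul.
rewrite -mulmxA (mulmxA X^T) XXE -scalemxAl -scalemxAr mulmxA.
by rewrite [X in _ * X = _]mxE; ring.
Qed.

(** [beta_tilde] is [betaU] plus the weight times the last coordinate of [betaU] times [e], and
    [betaU] is [theta] plus [G u / sqrt n]. *)
Lemma scaled_beta_tilde (theta : 'cV[R]_(k1 + 1)) (u : n.-tuple R) i :
  let z := dotp (ls_rows l) u + sn * theta l 0 in
  sn * (beta_tilde X s alpha (colv (Ydata X theta u)) - theta) i 0 =
  dotp (ls_rows i) u +
    weight s alpha ((ls_dir^T *m S *m ls_dir) 0 0) z * (ls_dir i 0 * z).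
Proof.
move=> z; set Y := colv _.
have YE : Y = X *m theta + colv u.
  by apply/matrixP => j h; rewrite !mxE tnth_mktuple ord1 mxE.
have bE : betaU X Y = theta + sn^-1 *: (ls_mx *m colv u).
  rewrite /betaU YE mulmxDr -!mulmxA (mulmxA X^T) mulKmx//; congr (_ + _).
  by rewrite /ls_mx -scalemxAl scalerA mulVf// scale1r mulmxA.
have zE : sn * betaU X Y l 0 = z.
  rewrite bE mxE mulrDr addrC [X in sn * X + _]mxE mulrA divff// mul1r.
  by rewrite /z dotp_ls_rows.
have lE : lambda_hat X s alpha Y = weight s alpha ((ls_dir^T *m S *m ls_dir) 0 0) z.
  by rewrite /lambda_hat sqnorm_betaR_betaU zE.
have comb (w : R) (b d v th : 'cV[R]_(k1 + 1)) : b = th + v ->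
    w *: (b + d) + (1 - w) *: b - th = w *: d + v.
  by move=> ->; apply/matrixP => p q; rewrite !mxE; ring.
rewrite /beta_tilde lE; set w := weight _ _ _ _.
rewrite betaR_betaU -zE dotp_ls_rows.
have -> : w *: (betaU X Y + betaU X Y l 0 *: ls_dir) + (1 - w) *: betaU X Y - theta =
    w *: (betaU X Y l 0 *: ls_dir) + sn^-1 *: (ls_mx *m colv u).
  by rewrite (comb _ _ _ _ _ bE).
rewrite [X in sn * X = _]mxE mulrDr [X in _ + sn * X = _]mxE.
rewrite [X in _ + X = _]mulrA divff// mul1r addrC; congr (_ + _).
by rewrite [X in sn * X = _]mxE [X in sn * (_ * X) = _]mxE; ring.
Qed.

Lemma FdistE (theta t : 'cV[R]_(k1 + 1)) :
  fine (Fdist X s alpha theta t) =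
  gprob s (avg_event s alpha l (fun i => t i 0) ls_rows (fun i => ls_dir i 0)
    ((ls_dir^T *m S *m ls_dir) 0 0) (sn * theta l 0)).
Proof.
rewrite /Fdist /PY /gprob; congr (fine (gauss_prob s _)).
by apply/seteqP; split=> u /= h i; have := h i; rewrite scaled_beta_tilde.
Qed.

End least_squares.

(** * Local asymptotics *)

Section shifted_model.
Context {R : realType} (k n : nat) (X : 'M[R]_(n, k)) (s : R) (s0 : 0 < s).
Implicit Types (theta d : 'cV[R]_k) (E : set (n.-tuple R)).

Definition mean_shift theta (j : 'I_n) : R := (X *m theta) j 0.

Definition prY theta E : R := gprob s (Ydata X theta @^-1` E).

Lemma measurable_Ydata_preimage theta E :
  measurable E -> measurable (Ydata X theta @^-1` E).
Proof.
move=> mE; rewrite -[X in measurable X]setTI.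
exact: (measurable_shift_tuple (mean_shift theta)).
Qed.

Lemma PY_prY theta E : measurable E -> PY X s theta E = (prY theta E)%:E.
Proof. by move=> mE; rewrite -gprobE//; exact: measurable_Ydata_preimage. Qed.

Lemma prY_le1 theta E : measurable E -> prY theta E <= 1.
Proof. by move=> mE; apply: gprob_le1; exact: measurable_Ydata_preimage. Qed.

Lemma prYC theta E : measurable E -> prY theta (~` E) = 1 - prY theta E.
Proof.
by move=> mE; rewrite /prY preimage_setC gprobC//; exact: measurable_Ydata_preimage.
Qed.

Lemma le_prY theta E E' : measurable E -> measurable E' -> E `<=` E' ->
  prY theta E <= prY theta E'.
Proof.
move=> mE mE' EE'; apply: le_gprob; try exact: measurable_Ydata_preimage.
by move=> u; exact: EE'.
Qed.

Lemma Ydata_add theta d u :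
  Ydata X (theta + d) u = Ydata X theta (shift_tuple (mean_shift d) u).
Proof.
apply: eq_from_tnth => i; rewrite !tnth_mktuple mulmxDr mxE /mean_shift.
by rewrite -addrA.
Qed.

Lemma prY_contiguity theta d E c r : measurable E -> 0 < c ->
  sumsq (mean_shift d) <= r ->
  prY (theta + d) E <= c * prY theta E + expR (r / s ^+ 2) / c.
Proof.
move=> mE c0 dr.
apply: le_trans (gprob_shift_contiguity s0 (measurable_Ydata_preimage theta mE) c0 dr).
rewrite le_eqVlt; apply/orP; left; apply/eqP; congr (gprob s _).
by apply/seteqP; split=> u /=; rewrite Ydata_add.
Qed.

Lemma prY_tv theta d E c r : measurable E -> 0 < c ->
  sumsq (mean_shift d) <= r ->
  prY (theta + d) E <= prY theta E + (c + (expR (r / s ^+ 2) - 1) / (4 * c)).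
Proof.
move=> mE c0 dr.
apply: le_trans (gprob_shift_tv s0 (measurable_Ydata_preimage theta mE) c0 dr).
rewrite le_eqVlt; apply/orP; left; apply/eqP; congr (gprob s _).
by apply/seteqP; split=> u /=; rewrite Ydata_add.
Qed.

Definition error_set (f : n.-tuple R -> R) (delta x : R) : set (n.-tuple R) :=
  [set Y | delta < `|f Y - x| ].

Lemma measurable_error_set f delta x :
  measurable_fun setT f -> measurable (error_set f delta x).
Proof.
move=> mf; apply: measurable_lt_set => //.
by apply: measurableT_comp => //; exact: measurable_funB.
Qed.

(** An estimate within [delta] of both values would put them at distance at most [2 delta]. *)
Lemma setC_error_set f delta x y : 2 * delta < `|x - y| ->
  ~` error_set f delta x `<=` error_set f delta y.
Proof.
move=> dxy Y /negP; rewrite -leNgt => h; rewrite /error_set/=.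
rewrite ltNge; apply/negP => h'; move: dxy; apply/negP; rewrite -leNgt.
rewrite (_ : x - y = (f Y - y) - (f Y - x)); last by ring.
by rewrite (le_trans (ler_normB _ _))//; lra.
Qed.

(** Le Cam's two-point bound: an estimate close to [x] is in error for [y], and the total variation
    bound carries this event from [theta + d] to [theta]. *)
Lemma two_point_error theta d f delta x y c r : measurable_fun setT f ->
  2 * delta < `|x - y| -> 0 < c -> sumsq (mean_shift d) <= r ->
  1 - (c + (expR (r / s ^+ 2) - 1) / (4 * c)) <=
  prY (theta + d) (error_set f delta x) + prY theta (error_set f delta y).
Proof.
move=> mf dxy c0 dr.
have mx := measurable_error_set delta x mf.
have my := measurable_error_set delta y mf.
have := le_prY (theta + d) (measurableC mx) my (setC_error_set dxy).
by rewrite prYC//; have := prY_tv theta my c0 dr; lra.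
Qed.

End shifted_model.

(** * Limits along a sequence of designs and the resulting error bounds *)

Section asymptotics.
Context {R : realType} (k1 : nat) (Q : 'M[R]_(k1 + 1, k1 + 1)).
Context (s alpha : R) (t : 'cV[R]_(k1 + 1)).
Hypotheses (s0 : 0 < s) (alpha0 : 0 < alpha) (Qpd : posdef Q) (Q12 : ursubmx Q = 0).
Let l : 'I_(k1 + 1) := rshift k1 ord0.

Let gram n (X : 'M[R]_(n, k1 + 1)) := n%:R^-1 *: (X^T *m X).

(** When the last coordinate of [beta] is 0 and [n > 0], [g] is the local parameter that enters
    [avg_event]. *)
Definition local_point (n : nat) (beta : 'cV[R]_(k1 + 1)) (g : R) : 'cV[R]_(k1 + 1) :=
  beta + (Num.sqrt n%:R)^-1 *: (g *: delta_mx l 0).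

Lemma local_point0 n beta : local_point n beta 0 = beta.
Proof. by rewrite /local_point scale0r scaler0 addr0. Qed.

Lemma local_point_add n beta g h :
  local_point n beta g =
  local_point n beta h + (Num.sqrt n%:R)^-1 *: ((g - h) *: delta_mx l 0).
Proof. by rewrite /local_point -addrA -scalerDr -scalerDl addrCA subrr addr0. Qed.

Lemma local_point_near n beta g rho : (0 < n)%N -> `|g| < rho ->
  enorm (local_point n beta g - beta) < rho / Num.sqrt n%:R.
Proof.
move=> n0 grho; have sn : 0 < Num.sqrt (n%:R : R) by rewrite sqrtr_gt0 ltr0n.
rewrite /local_point addrAC subrr add0r scalerA.
have -> : enorm (((Num.sqrt n%:R)^-1 * g) *: delta_mx l 0 : 'cV[R]_(k1 + 1)) =
    `|(Num.sqrt n%:R)^-1 * g|.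
  rewrite /enorm /sqnorm (bigD1 l)//= big1 => [|i il].
    by rewrite !mxE !eqxx mulr1 addr0 sqrtr_sqr.
  by rewrite !mxE (negbTE il) mulr0 expr0n.
by rewrite normrM mulrC normfV (gtr0_norm sn) ltr_pM2r// invr_gt0.
Qed.

Let quad (b : 'cV[R]_(k1 + 1)) (S : 'M[R]_(k1 + 1)) : R := (b^T *m S *m b) 0 0.

Let cvg_quad (X : forall n, 'M[R]_(n, k1 + 1)) (b : nat -> 'cV[R]_(k1 + 1)) b' :
  mxcvg (fun n => gram (X n)) Q -> mxcvg b b' ->
  (fun n => quad (b n) (gram (X n))) @ \oo --> quad b' Q.
Proof.
move=> cX cb; apply: (mxcvg_mul (mxcvg_mul _ cX) cb) => i j.
by rewrite mxE (_ : (fun n => _) = fun n => b n j i); [exact: cb|apply/funext => n; rewrite mxE].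
Qed.

(** The squared length equals [b^T S b], with limit [b^T Q b]; hence a bound that depends on the
    design only through [Q]. *)
Lemma near_sumsq_mean_shift (X : forall n, 'M[R]_(n, k1 + 1)) b e : 0 < e ->
  mxcvg (fun n => gram (X n)) Q ->
  \forall n \near \oo,
    sumsq (mean_shift (X n) ((Num.sqrt n%:R)^-1 *: b)) <= quad b Q + e.
Proof.
move=> e0 cX; have cb : mxcvg (fun=> b) b by exact: mxcvg_cst.
have := cvg_quad cX cb => /cvgr_le /(_ (quad b Q + e)).
rewrite ltrDl => /(_ e0) cq.
near=> n; have n0 : (0 < n)%N by near: n; exact: nbhs_infty_gt.
rewrite (_ : sumsq _ = quad b (gram (X n))); last first.
  rewrite /quad /gram -sumsq_shift//; apply: eq_bigr => j _.
  by rewrite /mean_shift -scalemxAr.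
by near: n.
Unshelve. all: by end_near. Qed.

Lemma near_inv_gram_diag : exists lo hi : R, [/\ 0 < lo, lo <= hi &
  forall X : forall n, 'M[R]_(n, k1 + 1), mxcvg (fun n => gram (X n)) Q ->
  \forall n \near \oo, forall i, lo <= invmx (gram (X n)) i i <= hi].
Proof.
pose v i := invmx Q i i.
have v0 i : 0 < v i by exact: posdef_inv_diag_gt0.
(* Crude bounds from sums: every limit [v i] lies strictly between [1 / w] and [hi]. They precede
   [X], so all later constants depend on the design only through [Q]. *)
pose hi := \sum_i 2 * v i; pose w := \sum_i 2 / v i.
have vhi i : 2 * v i <= hi.
  rewrite /hi (bigD1 i)//= lerDl; apply: sumr_ge0 => j _.
  by rewrite mulr_ge0// ltW.
have vw i : 2 / v i <= w.
  rewrite /w (bigD1 i)//= lerDl; apply: sumr_ge0 => j _.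
  by rewrite divr_ge0// ltW.
have w0 : 0 < w by apply: lt_le_trans (vw l); rewrite divr_gt0.
have low i : w^-1 <= v i / 2.
  by rewrite -[v i / 2]invrK lef_pV2 ?posrE ?invr_gt0 ?divr_gt0// invf_div.
exists w^-1, hi; split; first by rewrite invr_gt0.
  by have := low l; have := vhi l; have := v0 l; lra.
move=> X cX; apply: filter_forall => i.
have cV : mxcvg (fun n => invmx (gram (X n))) (invmx Q).
  by apply: mxcvg_inv => //; exact: posdef_unitmx.
have ci := cV i i; rewrite -/(v i) in ci.
have h1 : v i < hi by have := vhi i; have := v0 i; lra.
have h2 : w^-1 < v i by have := low i; have := v0 i; lra.
have n1 := cvgr_lt _ ci hi h1; have n2 := cvgr_gt _ ci _ h2.
near=> n; apply/andP; split; apply: ltW; near: n; [exact: n2|exact: n1].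
Unshelve. all: by end_near. Qed.

(** The limit of [D] is [Q11^-1 Q12], which is 0 by [Q12]. *)
Let cvg_ls_dir (X : forall n, 'M[R]_(n, k1 + 1)) :
  mxcvg (fun n => gram (X n)) Q ->
  mxcvg (fun n => ls_dir (X n)) (col_mx 0 (- 1%:M)).
Proof.
move=> cX.
have cA : mxcvg (fun n => ulsubmx (gram (X n))) (ulsubmx Q).
  move=> i j; rewrite !mxE (_ : (fun n => _) = fun n => gram (X n) (lshift 1 i) (lshift 1 j)).
    exact: cX.
  by apply/funext => n; rewrite 2!mxE.
have cB : mxcvg (fun n => ursubmx (gram (X n))) 0.
  rewrite -Q12 => i j; rewrite !mxE
    (_ : (fun n => _) = fun n => gram (X n) (lshift 1 i) (rshift k1 j)).
    exact: cX.
  by apply/funext => n; rewrite 2!mxE.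
have cAV : mxcvg (fun n => invmx (ulsubmx (gram (X n)))) (invmx (ulsubmx Q)).
  by apply: mxcvg_inv => //; exact/posdef_unitmx/posdef_ulsubmx.
have cD : mxcvg (fun n => invmx (ulsubmx (gram (X n))) *m ursubmx (gram (X n))) 0.
  by rewrite -(mulmx0 _ (invmx (ulsubmx Q))); exact: mxcvg_mul.
move=> i j; case: (split_ordP i) => i' ->.
  rewrite col_mxEu (_ : (fun n => _) = fun n =>
    (invmx (ulsubmx (gram (X n))) *m ursubmx (gram (X n))) i' j); first exact: cD.
  by apply/funext => n; rewrite col_mxEu.
rewrite col_mxEd (_ : (fun n => _) = fun=> (- 1%:M : 'M[R]_1) i' j); first exact: cvg_cst.
by apply/funext => n; rewrite col_mxEd.
Qed.

Lemma Fdist_gap (eps : R) : eps != 0 -> exists2 c : R, 0 < c &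
  forall X : forall n, 'M[R]_(n, k1 + 1), mxcvg (fun n => gram (X n)) Q ->
  forall beta : 'cV[R]_(k1 + 1), dsubmx beta = 0 ->
  \forall n \near \oo,
    c <= `|fine (Fdist (X n) s alpha (local_point n beta (eps - t l 0)) t) -
           fine (Fdist (X n) s alpha (local_point n beta (- t l 0)) t)|.
Proof.
move=> eps0; have [lo [hi [lo0 lohi diag]]] := near_inv_gram_diag.
pose dir : 'cV[R]_(k1 + 1) := col_mx 0 (- 1%:M).
have [b hb] := avg_event_gap s0 alpha0 l (fun i => t i 0) (quad dir Q + 1) lo0 lohi eps0.
(* The shift lowers the other coordinates only: coordinate [l] must keep its law, since its interval
   carries the gap. The [+ 1] in the two quadratic-form bounds is slack above their limits. *)
pose bv : 'cV[R]_(k1 + 1) := \col_i if i == l then 0 else b i.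
have [c [kap [c0 kap0 hc]]] := hb (quad bv Q + 1).
exists c => // X cX beta beta2.
have diagX := diag X cX.
have uS := mxcvg_unitmx cX (posdef_unitmx Qpd).
have uA : \forall n \near \oo, ulsubmx (gram (X n)) \in unitmx.
  apply: (mxcvg_unitmx _ (posdef_unitmx (posdef_ulsubmx Qpd))) => i j.
  rewrite !mxE (_ : (fun n => _) = fun n => gram (X n) (lshift 1 i) (lshift 1 j)).
    exact: cX.
  by apply/funext => n; rewrite 2!mxE.
have cd : mxcvg (fun n => ls_dir (X n)) dir by exact: cvg_ls_dir.
have qX : \forall n \near \oo, quad (ls_dir (X n)) (gram (X n)) <= quad dir Q + 1.
  by apply: (cvgr_le _ (cvg_quad cX cd)); rewrite ltrDl.
have mX := near_sumsq_mean_shift bv ltr01 cX.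
have eX : \forall n \near \oo, forall i, i != l -> `|ls_dir (X n) i 0| <= kap.
  apply: filter_forall => i; have [il|il] := eqVneq i l; first exact: nearW.
  suff : \forall n \near \oo, `|ls_dir (X n) i 0| <= kap by apply: filterS => n.
  apply: cvgr0_norm_le => //; have := cd i 0.
  move: il; case: (split_ordP i) => i' -> il; first by rewrite col_mxEu mxE.
  by move: il; rewrite ord1 eqxx.
have beta_l : beta l 0 = 0.
  by have /matrixP/(_ 0 0) := beta2; rewrite !mxE.
near=> n.
have n0 : (0 < n)%N by near: n; exact: nbhs_infty_gt.
have uSn : gram (X n) \in unitmx by near: n.
have uAn : ulsubmx (gram (X n)) \in unitmx by near: n.
have sn : Num.sqrt (n%:R : R) != 0 by rewrite gt_eqF// sqrtr_gt0 ltr0n.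
have coord g : Num.sqrt n%:R * local_point n beta g l 0 = g.
  by rewrite /local_point !mxE beta_l !eqxx mulr1 add0r mulVKf.
have dn : forall i, lo <= invmx (gram (X n)) i i <= hi by near: n.
rewrite !FdistE// !coord.
apply: (hc _ _ _ _ (mean_shift (X n) ((Num.sqrt n%:R)^-1 *: bv))).
- by move=> i; rewrite sumsq_ls_rows.
- by near: n.
- move=> i il; transitivity (bv i 0); last by rewrite mxE (negbTE il).
  rewrite -(dotp_ls_shift n0 uSn bv i); apply: eq_bigr => j _.
  by rewrite /mean_shift -scalemxAr.
- transitivity (bv l 0); last by rewrite mxE eqxx.
  rewrite -(dotp_ls_shift n0 uSn bv l); apply: eq_bigr => j _.
  by rewrite /mean_shift -scalemxAr.
- by rewrite /ls_dir /l col_mxEd !mxE eqxx.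
- by near: n.
- apply/andP; split; last by near: n.
  by rewrite /gram -sumsq_shift// sumsq_ge0.
Unshelve. all: by end_near. Qed.

Lemma err_probE n (X : 'M[R]_(n, k1 + 1)) (f : n.-tuple R -> R) theta delta :
  measurable_fun setT f ->
  err_prob X s alpha t f theta delta =
  (prY X s theta (error_set f delta (fine (Fdist X s alpha theta t))))%:E.
Proof. by move=> mf; rewrite -PY_prY//; exact: measurable_error_set. Qed.

Lemma err_prob_le_sup n (X : 'M[R]_(n, k1 + 1)) (f : n.-tuple R -> R) beta g rho delta :
  (0 < n)%N -> `|g| < rho ->
  (err_prob X s alpha t f (local_point n beta g) delta <=
   sup_err X s alpha t f beta rho delta)%E.
Proof.
move=> n0 grho; apply: ereal_sup_ubound.
by exists (local_point n beta g) => //; exact: local_point_near.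
Qed.

(** The larger of two error probabilities is at least half their sum. The threshold on [n] does not
    depend on the estimator, so the bound passes to the infimum. *)
Lemma near_minimax_err_ge (eps c cc e delta rho : R) (X : forall n, 'M[R]_(n, k1 + 1)) beta :
  mxcvg (fun n => gram (X n)) Q ->
  (\forall n \near \oo,
    c <= `|fine (Fdist (X n) s alpha (local_point n beta (eps - t l 0)) t) -
           fine (Fdist (X n) s alpha (local_point n beta (- t l 0)) t)|) ->
  2 * delta < c -> 0 < cc -> 0 < e -> `|eps - t l 0| < rho -> `|t l 0| < rho ->
  \forall n \near \oo,
    (((1 - (cc + (expR ((quad (eps *: delta_mx l 0) Q + e) / s ^+ 2) - 1) / (4 * cc))) / 2)%:E <=
    minimax_err (X n) s alpha t beta rho delta)%E.
Proof.
move=> cX gap dc cc0 e0 g1 g2.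
have mX := near_sumsq_mean_shift (eps *: delta_mx l 0) e0 cX.
near=> n.
have n0 : (0 < n)%N by near: n; exact: nbhs_infty_gt.
apply: le_ereal_inf_tmp => _ [f mf <-].
have gapn : c <= `|fine (Fdist (X n) s alpha (local_point n beta (eps - t l 0)) t) -
    fine (Fdist (X n) s alpha (local_point n beta (- t l 0)) t)| by near: n.
set x := fine (Fdist (X n) s alpha (local_point n beta (eps - t l 0)) t).
set y := fine (Fdist (X n) s alpha (local_point n beta (- t l 0)) t).
have dxy : 2 * delta < `|x - y| by exact: lt_le_trans gapn.
have mn : sumsq (mean_shift (X n) ((Num.sqrt n%:R)^-1 *: (eps *: delta_mx l 0))) <=
    quad (eps *: delta_mx l 0) Q + e by near: n.
have := two_point_error s0 (local_point n beta (- t l 0)) mf dxy cc0 mn.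
have E : local_point n beta (eps - t l 0) = local_point n beta (- t l 0) +
    (Num.sqrt n%:R)^-1 *: (eps *: delta_mx l 0).
  by rewrite (local_point_add n beta _ (- t l 0)) opprK subrK.
rewrite -E; set p := prY _ _ _ _; set q := prY _ _ _ _ => pq.
have hp : (p%:E <= sup_err (X n) s alpha t f beta rho delta)%E.
  by rewrite -err_probE//; exact: err_prob_le_sup.
have hq : (q%:E <= sup_err (X n) s alpha t f beta rho delta)%E.
  by rewrite -err_probE//; apply: err_prob_le_sup => //; rewrite normrN.
have [h|h] := leP p q.
  by apply: le_trans hq; rewrite lee_fin; lra.
by apply: le_trans hp; rewrite lee_fin; lra.
Unshelve. all: by end_near. Qed.

(** By contiguity the estimator stays close to the value at [beta] under the local alternative too,
    hence away from the true value there. *)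
Lemma sup_err_cvg1 (g c delta rho : R) (X : forall n, 'M[R]_(n, k1 + 1)) beta
    (f : forall n, n.-tuple R -> R) :
  mxcvg (fun n => gram (X n)) Q ->
  (forall n, measurable_fun setT (f n)) ->
  (\forall n \near \oo,
    c <= `|fine (Fdist (X n) s alpha (local_point n beta g) t) -
           fine (Fdist (X n) s alpha beta t)|) ->
  2 * delta < c -> `|g| < rho ->
  (fun n => err_prob (X n) s alpha t (f n) beta delta) @ \oo --> 0%E ->
  (fun n => sup_err (X n) s alpha t (f n) beta rho delta) @ \oo --> 1%E.
Proof.
move=> cX mf gap dc grho cv0.
have mX := near_sumsq_mean_shift (g *: delta_mx l 0) ltr01 cX.
have sup_le1 n : (sup_err (X n) s alpha t (f n) beta rho delta <= 1)%E.
  apply: ge_ereal_sup => _ [theta _ <-]; rewrite err_probE// lee_fin.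
  by apply: prY_le1; exact: measurable_error_set.
pose w := expR ((quad (g *: delta_mx l 0) Q + 1) / s ^+ 2).
have w0 : 0 < w by exact: expR_gt0.
have lower (eta : R) : 0 < eta -> \forall n \near \oo,
    ((1 - eta)%:E <= sup_err (X n) s alpha t (f n) beta rho delta)%E.
  (* Makes the second contiguity term [w / cc] equal to [eta / 2]; the threshold [eta / (2 cc)]
     below makes the first one at most [eta / 2]. *)
  move=> eta0; pose cc := 2 * w / eta.
  have cc0 : 0 < cc by apply: divr_gt0 => //; exact: mulr_gt0.
  have small : \forall n \near \oo, prY (X n) s beta
      (error_set (f n) delta (fine (Fdist (X n) s alpha beta t))) < eta / (2 * cc).
    have /fine_cvgP[_ cv] := cv0.
    have small0 : 0 < eta / (2 * cc) by apply: divr_gt0 => //; exact: mulr_gt0.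
    have h := cvgr_lt _ cv _ small0; near=> n.
    have : fine (err_prob (X n) s alpha t (f n) beta delta) < eta / (2 * cc).
      by near: n; exact: h.
    by rewrite err_probE.
  near=> n.
  have n0 : (0 < n)%N by near: n; exact: nbhs_infty_gt.
  have gapn : c <= `|fine (Fdist (X n) s alpha (local_point n beta g) t) -
    fine (Fdist (X n) s alpha beta t)| by near: n.
  have sn : prY (X n) s beta
    (error_set (f n) delta (fine (Fdist (X n) s alpha beta t))) < eta / (2 * cc) by near: n.
  set x := fine (Fdist (X n) s alpha (local_point n beta g) t).
  set y := fine (Fdist (X n) s alpha beta t).
  have dxy : 2 * delta < `|x - y| by exact: lt_le_trans gapn.
  have mn : sumsq (mean_shift (X n) ((Num.sqrt n%:R)^-1 *: (g *: delta_mx l 0))) <=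
    quad (g *: delta_mx l 0) Q + 1 by near: n.
  have mx := measurable_error_set delta x (mf n).
  have my := measurable_error_set delta y (mf n).
  have E : local_point n beta g = beta + (Num.sqrt n%:R)^-1 *: (g *: delta_mx l 0).
    by [].
  apply: le_trans (err_prob_le_sup (X n) (f n) beta delta n0 grho).
  rewrite err_probE// -/x lee_fin.
  have := le_prY (X n) s (local_point n beta g) (measurableC mx) my (setC_error_set dxy).
  rewrite prYC//; have := prY_contiguity s0 beta my cc0 mn; rewrite -E -/w.
  have : cc * prY (X n) s beta (error_set (f n) delta y) <= eta / 2.
    rewrite -ler_pdivlMl//; apply: (le_trans (ltW sn)).
    by rewrite invfM mulrA [_^-1 * _]mulrC.
  have -> : w / cc = eta / 2 by rewrite /cc; field; rewrite !gt_eqF.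
  by move=> *; lra.
apply/fine_cvgP; split.
  (* With [eta = 1] the lower bound is 0, which together with the upper bound 1 makes the supremum
     finite. *)
  have := lower 1 ltr01; apply: filterS => n h.
  rewrite fin_numE; apply/andP; split.
    by rewrite gt_eqF// (lt_le_trans _ h)// ltNyr.
  by rewrite lt_eqF// (le_lt_trans (sup_le1 n))// ltry.
apply/cvgrPdist_le => eta eta0; have := lower eta eta0; apply: filterS => n /= h.
have := sup_le1 n; move: h; case: (sup_err _ _ _ _ _ _ _ _) => [x||]//=.
  rewrite !lee_fin => h1 h2; rewrite ger0_norm ?subr_ge0//; lra.
Unshelve. all: by end_near. Qed.

Lemma near_le_limn_einf (u : (\bar R)^nat) (x : \bar R) :
  (\forall n \near \oo, (x <= u n)%E) -> (x <= limn_einf u)%E.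
Proof.
move=> [N _ h]; rewrite limn_einf_lim (cvg_lim _ (@cvg_einfs_sup _ u))//.
apply: le_ereal_sup_tmp; exists (einfs u N); first by exists N.
by apply: le_ereal_inf_tmp => _ [n /= Nn <-]; exact: h.
Qed.

(** With both the free constant and the shift equal to [eps], and slack [eps^2], the exponent is of
    order [eps^2], so the total variation bound is of order [eps]. *)
Lemma small_tv_pair (tau : R) : 0 < tau -> exists eps : R, [/\ 0 < eps, eps <= 1 &
  eps + (expR ((quad (eps *: delta_mx l 0) Q + eps ^+ 2) / s ^+ 2) - 1) / (4 * eps) <= tau].
Proof.
move=> tau0; pose qd := quad (delta_mx l 0) Q.
have qd0 : 0 < qd.
  apply: (proj2 Qpd); apply/eqP => /matrixP/(_ l 0).
  by rewrite !mxE !eqxx/= => /eqP; rewrite oner_eq0.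
pose B := (qd + 1) / s ^+ 2.
have B0 : 0 < B by rewrite divr_gt0 ?exprn_gt0// addr_gt0.
pose m := Num.min 1 tau.
have m0 : 0 < m by rewrite lt_min ltr01.
have m1 : m <= 1 by rewrite ge_min lexx.
have mtau : m <= tau by rewrite ge_min lexx orbT.
have B2 : 0 < 2 * (1 + B) by rewrite mulr_gt0// addr_gt0.
(* Ensures [eps <= 1/2] and [eps (1 + B) <= tau / 2]; the exponent [x] is then at most [1/2], where
   [exp x - 1 <= 2 x]. *)
pose eps := m / (2 * (1 + B)).
have e0 : 0 < eps by rewrite divr_gt0.
have eE : eps * (2 * (1 + B)) = m by rewrite divfK ?gt_eqF.
have eB0 : 0 < eps * B by rewrite mulr_gt0.
have e1 : eps <= 1 / 2 by lra.
exists eps; split => //; first by lra.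
have -> : (quad (eps *: delta_mx l 0) Q + eps ^+ 2) / s ^+ 2 = eps * (eps * B).
  rewrite /quad trmx_scale -scalemxAl -scalemxAr -scalemxAl scalerA mxE -/(quad _ _).
  by rewrite -/qd /B; field; rewrite gt_eqF.
set x := eps * (eps * B).
have x0 : 0 <= x by rewrite mulr_ge0 ?ltW.
have x2 : x <= 1 / 2 by rewrite /x; nra.
(* [expR x <= (1 - x)^-1] *)
have ex : expR x - 1 <= 2 * x.
  have h : expR x * (1 - x) <= 1.
    rewrite -[leRHS](expRxMexpNx_1 x) ler_wpM2l ?expR_ge0//.
    by have := expR_ge1Dx (- x); lra.
  have := expR_ge0 x; nra.
apply: (@le_trans _ _ (eps + eps * B / 2)); last by lra.
have e4 : 0 < 4 * eps by lra.
rewrite lerD2l ler_pdivrMr//; apply: le_trans ex _.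
by rewrite /x; nra.
Qed.

End asymptotics.

(** * Choice of the constants and the three claims *)

Unset Implicit Arguments. Set Strict Implicit.

Theorem theorem13 (R : realType) (k1 : nat) (Q : 'M[R]_(k1 + 1, k1 + 1))
  (sigma alpha : R) (t : 'cV[R]_(k1 + 1)) :
  (0 < k1)%N -> 0 < sigma -> 0 < alpha ->
  posdef Q -> ursubmx Q = 0 ->
  exists delta0 rho0 : R, 0 < delta0 /\ 0 < rho0 /\
  forall X : forall n : nat, 'M[R]_(n, k1 + 1),
    (forall n : nat, (k1 + 1 <= n)%N -> \rank (X n) = (k1 + 1)%N) ->
    (fun n : nat => (n%:R)^-1 *: ((X n)^T *m X n)) @ \oo --> Q ->
  forall beta : 'cV[R]_(k1 + 1), dsubmx beta = 0 ->
  (* (i) *)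
  (forall Fhat : forall n : nat, n.-tuple R -> R,
     (forall n : nat, estimators n (Fhat n)) ->
     (forall delta : R, 0 < delta ->
        (fun n : nat => err_prob (X n) sigma alpha t (Fhat n) beta delta)
          @ \oo --> 0%E) ->
     (fun n : nat => sup_err (X n) sigma alpha t (Fhat n) beta rho0 delta0)
       @ \oo --> 1%E) /\
  (* (ii) *)
  (0 < limn_einf (fun n : nat => minimax_err (X n) sigma alpha t beta rho0 delta0))%E /\
  (* (iii) *)
  ((1/2)%:E <= ereal_sup [set limn_einf
       (fun n : nat => minimax_err (X n) sigma alpha t beta rho0 delta)
       | delta in [set delta : R | (0 < delta)%R]])%E.
Proof.
move=> _ s0 alpha0 Qpd Q12.
pose l : 'I_(k1 + 1) := rshift k1 ord0.
have half_gt0 : 0 < 1 / 2 :> R by lra.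
have [eps2 [eps2_gt0 eps2_le1 tv2]] := small_tv_pair s0 Qpd half_gt0.
have [c2 c2_gt0 gap2] := Fdist_gap t s0 alpha0 Qpd Q12 (lt0r_neq0 eps2_gt0).
(* Claim (i) needs [beta] itself as one of the two points. If [t_l = 0] it is the point [- t_l],
   paired with [eps = 1]; otherwise [eps = t_l] makes [eps - t_l] equal to 0. *)
have [g1 [c1 [g1_le c1_gt0 gap1]]] : exists g c : R, [/\ `|g| <= `|t l 0| + 1, 0 < c &
    forall X : forall n, 'M[R]_(n, k1 + 1),
      mxcvg (fun n => n%:R^-1 *: ((X n)^T *m X n)) Q ->
    forall beta : 'cV[R]_(k1 + 1), dsubmx beta = 0 ->
    \forall n \near \oo,
      c <= `|fine (Fdist (X n) sigma alpha (local_point n beta g) t) -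
             fine (Fdist (X n) sigma alpha beta t)|].
  have [tl0|tl0] := eqVneq (t l 0) 0.
    have [c c0 hc] := Fdist_gap t s0 alpha0 Qpd Q12 (oner_neq0 R).
    exists 1, c; split=> // [|X cX beta b2].
      by rewrite normr1 lerDr.
    have := hc X cX beta b2; rewrite -/l tl0 subr0 oppr0.
    by apply: filterS => n; rewrite local_point0.
  have [c c0 hc] := Fdist_gap t s0 alpha0 Qpd Q12 tl0.
  exists (- t l 0), c; split=> // [|X cX beta b2]; first by rewrite normrN lerDl.
  have := hc X cX beta b2; rewrite -/l subrr.
  by apply: filterS => n; rewrite local_point0 distrC.
(* Twice [delta0] is below both gaps, and [rho0] exceeds every local parameter used, all bounded by
   [|t_l| + 1]. *)
pose delta0 := Num.min c1 c2 / 3; pose rho0 := `|t l 0| + 2.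
have cm : 0 < Num.min c1 c2 by rewrite lt_min c1_gt0.
have m1 : Num.min c1 c2 <= c1 by rewrite ge_min lexx.
have m2 : Num.min c1 c2 <= c2 by rewrite ge_min lexx orbT.
have rho_gt (g : R) : `|g| <= `|t l 0| + 1 -> `|g| < rho0.
  by move=> h; apply: (le_lt_trans h); rewrite /rho0; lra.
have shift_le (eps : R) : 0 < eps -> eps <= 1 -> `|eps - t l 0| <= `|t l 0| + 1.
  by move=> e0 e1; rewrite (le_trans (ler_normB _ _))// addrC lerD2l gtr0_norm.
have tl_le : `|t l 0| <= `|t l 0| + 1 by rewrite lerDl.
exists delta0, rho0; split; first by rewrite divr_gt0.
split; first by rewrite /rho0 ltr_wpDl.
move=> X _ /cvg_mxcvg cX beta beta2; split; [|split].
- move=> Fhat mF cv; apply: (sup_err_cvg1 s0 cX mF (gap1 X cX beta beta2)).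
  + by rewrite /delta0; lra.
  + exact: rho_gt.
  + by apply: cv; rewrite divr_gt0.
(* The pair behind [tv2] has total variation bound [1/2], and [(1 - 1/2) / 2 = 1/4]. *)
- apply: (@lt_le_trans _ _ (1 / 4)%:E); first by rewrite lte_fin; lra.
  apply: near_le_limn_einf.
  have dc : 2 * delta0 < c2 by rewrite /delta0; lra.
  have := near_minimax_err_ge s0 cX (gap2 X cX beta beta2) dc eps2_gt0
    (exprn_gt0 2 eps2_gt0) (rho_gt _ (shift_le _ eps2_gt0 eps2_le1)) (rho_gt _ tl_le).
  apply: filterS => n; apply: le_trans; rewrite lee_fin; move: tv2; lra.
(* For each [e] a pair with total variation bound [e] gives the limit inferior [(1 - e) / 2] at
   least, for some [delta] depending on [e]; the supremum over [delta] removes this loss. *)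
apply/lee_addgt0Pr => e e0.
have [eps [eps_gt0 eps_le1 tv]] := small_tv_pair s0 Qpd e0.
have [c c_gt0 gap] := Fdist_gap t s0 alpha0 Qpd Q12 (lt0r_neq0 eps_gt0).
apply: (@le_trans _ _ (((1 - e) / 2)%:E + e%:E)%E).
  by rewrite -EFinD lee_fin; lra.
rewrite leeD2r//; apply: le_ereal_sup_tmp.
exists (limn_einf (fun n => minimax_err (X n) sigma alpha t beta rho0 (c / 3))).
  by exists (c / 3) => //=; rewrite divr_gt0.
apply: near_le_limn_einf.
have dc : 2 * (c / 3) < c by lra.
have := near_minimax_err_ge s0 cX (gap X cX beta beta2) dc eps_gt0
  (exprn_gt0 2 eps_gt0) (rho_gt _ (shift_le _ eps_gt0 eps_le1)) (rho_gt _ tl_le).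
by apply: filterS => n; apply: le_trans; rewrite lee_fin; move: tv; lra.
Qed.
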